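(* Let $n\ge 1$, let $\Delta\subset\mathbb{R}^n$ be an $n$-simplex with vertices $\mathbf{x}_0,\dots,\mathbf{x}_n$, and let $f\colon\Delta\to\mathbb{R}$ be convex. For a partition $\mathcal{K}=\{K_1,\dots,K_p\}$ of $N=\{0,1,\dots,n\}$ define $$F(\mathcal{K})=\sum_{i=1}^p \operatorname{card}(K_i)\,\operatorname{Avg}(f,\Delta_{K_i}).$$ If $\mathcal{K}$ and $\mathcal{L}$ are partitions of $N$ with $\mathcal{L}\prec\mathcal{K}$, then $F(\mathcal{K})\le F(\mathcal{L})$.
   Context: $\mathbf{x}_0,\dots,\mathbf{x}_n\in\mathbb{R}^n$ are affinely independent (the vectors $\mathbf{x}_i-\mathbf{x}_0$, $i=1,\dots,n$, are linearly independent) and $\Delta=\operatorname{conv}\{\mathbf{x}_0,\dots,\mathbf{x}_n\}$. For nonempty $K\subset N$ with $\operatorname{card}K=k+1$, $\Delta_K=\operatorname{conv}\{\mathbf{x}_i: i\in K\}$ is a $k$-simplex (a face of $\Delta$). For a $k$-simplex $\Sigma$ and integrable $g\colon\Sigma\to\mathbb{R}$, $\operatorname{Avg}(g,\Sigma)=\frac{1}{\operatorname{Vol}_k(\Sigma)}\int_\Sigma g\,d\mathbf{x}$, where integration is with respect to $k$-dimensional Lebesgue measure on the affine hull of $\Sigma$ and $\operatorname{Vol}_k$ is $k$-dimensional volume; for a $0$-simplex $\{\mathbf{y}\}$, $\operatorname{Avg}(g,\{\mathbf{y}\})=g(\mathbf{y})$. A partition of $N$ is a family of pairwise disjoint nonempty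 subsets of $N$ whose union is $N$. For partitions $\mathcal{K},\mathcal{L}$ of $N$, $\mathcal{L}\prec\mathcal{K}$ ($\mathcal{L}$ refines $\mathcal{K}$) means every element of $\mathcal{L}$ is a subset of some element of $\mathcal{K}$. *)

(* Defs.v *)
From Stdlib Require Import Reals Lra List Arith Classical ClassicalEpsilon.
Open Scope R_scope.

(* Points of R^n are encoded as functions nat -> R (coordinates j < n;
   vertices are required to vanish at coordinates j >= n). *)

(* Total version of the 1-dimensional Riemann integral over [a,b]
   (value 0 when f is not Riemann integrable; the value does not depend
   on the integrability witness). *)
Definition Rint (f : R -> R) (a b : R) : R :=
  match excluded_middle_informative (inhabited (Riemann_integrable f a b)) with
  | left H => RiemannInt (epsilon H (fun _ => True))
  | right _ => 0
  end.

(* SI k s h = integral of h over the k-dimensional simplex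
   { (t_1,...,t_k) | t_i >= 0, t_1 + ... + t_k <= s } (Lebesgue measure on R^k),
   computed as an iterated integral. *)
Fixpoint SI (k : nat) (s : R) (h : list R -> R) : R :=
  match k with
  | O => h nil
  | S k' => Rint (fun u => SI k' (s - u) (fun t => h (u :: t))) 0 s
  end.

Fixpoint comb (t : list R) (ws : list (nat -> R)) (j : nat) : R :=
  match t, ws with
  | a :: t', w :: ws' => a * w j + comb t' ws' j
  | _, _ => 0
  end.

(* Average of g over the k-simplex with vertex list v0 :: rest (k = length rest),
   computed via the affine parametrization
   t |-> v0 + sum_m t_m (v_m - v0) of the simplex by the standard k-simplex;
   this affine bijection scales k-dimensional volume by a constant factor, so
   the average is unchanged.  For k = 0 this is g v0. *)
Definition Avg (g : (nat -> R) -> R) (vs : list (nat -> R)) : R :=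
  match vs with
  | nil => 0
  | v0 :: rest =>
      let k := length rest in
      let ws := map (fun w => fun j => w j - v0 j) rest in
      SI k 1 (fun t => g (fun j => v0 j + comb t ws j)) / SI k 1 (fun _ => 1)
  end.

Definition in_simplex (x : nat -> nat -> R) (n : nat) (p : nat -> R) : Prop :=
  exists lam : nat -> R,
    (forall i, (i <= n)%nat -> 0 <= lam i) /\
    sum_f_R0 lam n = 1 /\
    forall j, p j = sum_f_R0 (fun i => lam i * x i j) n.

Definition affinely_independent (x : nat -> nat -> R) (n : nat) : Prop :=
  forall c : nat -> R,
    (forall j, (j < n)%nat ->
       sum_f_R0 (fun i => c (S i) * (x (S i) j - x 0%nat j)) (pred n) = 0) ->
    forall i, (1 <= i <= n)%nat -> c i = 0.

Definition convex_on (S : (nat -> R) -> Prop) (f : (nat -> R) -> R) : Prop :=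
  forall p q t, S p -> S q -> 0 <= t <= 1 ->
    f (fun j => t * p j + (1 - t) * q j) <= t * f p + (1 - t) * f q.

(* A partition of N = {0,...,n} is encoded by a labelling c : nat -> nat with
   c i <= n for i <= n; its blocks are the nonempty fibres
   block c n l = { i <= n | c i = l }, l = 0..n. *)
Definition is_labelling (n : nat) (c : nat -> nat) : Prop :=
  forall i, (i <= n)%nat -> (c i <= n)%nat.

Definition block (c : nat -> nat) (n l : nat) : list nat :=
  filter (fun i => Nat.eqb (c i) l) (seq 0 (S n)).

Definition refines (n : nat) (cL cK : nat -> nat) : Prop :=
  forall i j, (i <= n)%nat -> (j <= n)%nat -> cL i = cL j -> cK i = cK j.

(* F(K) = sum over blocks K_i of card(K_i) * Avg(f, Delta_{K_i});
   empty fibres contribute 0 since their cardinality is 0. *)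
Definition Fpart (f : (nat -> R) -> R) (x : nat -> nat -> R) (n : nat)
    (c : nat -> nat) : R :=
  sum_f_R0 (fun l => INR (length (block c n l)) * Avg f (map x (block c n l))) n.

(* Main.v *)
(* The uniform measure on a simplex is the limit of the uniform measures on its
   grid points [sum_i (a_i / m) v_i], with natural weights [a_i] of sum [m]. If
   the vertices are split into [A] and [B], a grid point with weight [j] on [A]
   is the convex combination, with coefficients [j / m] and [(m - j) / m], of a
   grid point of level [j] of [A] and one of level [m - j] of [B]. Convexity and
   the identity
     sum_j j N_a(j) N_b(m - j) = a / (a + b) * m * N_(a+b)(m)
   for the number [N_k(m)] of grid points give, as [m] tends to infinity,
     (a + b) Avg(A U B) <= a Avg(A) + b Avg(B),
   and a refinement is a sequence of such splittings. A convex function on a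
   closed simplex may jump at the boundary, so the convergence of the grid
   averages rests on bounded variation instead of continuity: all slice
   integrals are products of monotone and convex functions of the slicing
   variable. Grid sums are symmetric in the vertices, which makes Fubini and
   changes of variables for the iterated integral unnecessary. *)

Require Import Defs.
From Stdlib Require Import Reals Lra Lia Factorial RList.
From Stdlib Require Import FunctionalExtensionality ClassicalEpsilon.
From Coquelicot Require Import Coquelicot.
From Stdlib Require Import List Permutation.
Open Scope R_scope.

(** * Riemann sums of functions of bounded variation *)

(** [IsStepFun] constrains a function on the open cells of a subdivision only, and these cells lie
    strictly between [a] and [b]. *)
Lemma IsStepFun_ext (f g : R -> R) (a b : R) :
  a <= b -> (forall t, a < t < b -> f t = g t) ->
  IsStepFun f a b -> IsStepFun g a b.
Proof.
  intros hab hfg [l [lf [h1 [h2 [h3 [h4 h5]]]]]].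
  exists l, lf. repeat split; auto.
  intros i hi t ht. rewrite <- hfg. { now apply h5. }
  rewrite (Rmin_left _ _ hab) in h2. rewrite (Rmax_right _ _ hab) in h3.
  destruct ht as [ht1 ht2]. split.
  - apply Rle_lt_trans with (2 := ht1). rewrite <- h2.
    apply RList_P5; auto. apply RList_P3. exists i. split; auto. lia.
  - apply Rlt_le_trans with (1 := ht2). rewrite <- h3.
    apply RList_P7; auto. apply RList_P3. exists (S i). split; auto. lia.
Qed.

Lemma RiemannInt_SF_ext (a b : R) (f g : StepFun a b) :
  a <= b -> (forall t, a < t < b -> f t = g t) ->
  RiemannInt_SF f = RiemannInt_SF g.
Proof.
  intros hab hfg. apply Rle_antisym; apply StepFun_P37; auto;
  intros t ht; rewrite (hfg t ht); lra.
Qed.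

(** Gluing step for building approximations cell by cell; at [b] itself the old value is kept. *)
Lemma StepFun_extend (a b c v : R) (phi : StepFun a b) :
  a <= b -> b <= c ->
  exists phi' : StepFun a c,
    (forall t, t <= b -> phi' t = phi t) /\ (forall t, b < t -> phi' t = v) /\
    RiemannInt_SF phi' = RiemannInt_SF phi + v * (c - b).
Proof.
  intros hab hbc.
  set (F := fun t => if Rle_dec t b then phi t else v).
  assert (F1 : forall t, t <= b -> F t = phi t).
  { intros t ht. unfold F. destruct (Rle_dec t b); lra. }
  assert (F2 : forall t, b < t -> F t = v).
  { intros t ht. unfold F. destruct (Rle_dec t b); lra. }
  assert (p1 : IsStepFun F a b).
  { apply IsStepFun_ext with phi; auto; [|apply (pre phi)].
    intros t ht. symmetry. apply F1. lra. }
  assert (p2 : IsStepFun F b c).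
  { apply IsStepFun_ext with (fct_cte v); auto; [|apply StepFun_P4].
    intros t ht. symmetry. apply F2. lra. }
  exists (mkStepFun (StepFun_P46 p1 p2)). simpl. split; [|split]; auto.
  rewrite <- (StepFun_P43 p1 p2). f_equal.
  - apply RiemannInt_SF_ext; auto. simpl. intros t ht. apply F1. lra.
  - rewrite <- StepFun_P18. apply RiemannInt_SF_ext; auto. simpl.
    intros t ht. rewrite F2 by lra. reflexivity.
Qed.

(* A majorant of the variation of [G] that is additive over adjacent intervals:
   bounded variation without suprema over subdivisions. *)
Definition var_bound (G P : R -> R) (a b : R) : Prop :=
  forall x y, a <= x -> x <= y -> y <= b -> Rabs (G x - G y) <= P y - P x.

(** On each cell [phi] is the value of [G] at the left end and [psi] the increment of [P] over the
    cell; the increments telescope. *)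
Lemma var_bound_step (G P : R -> R) (a d : R) (N : nat) :
  0 <= d -> var_bound G P a (a + INR N * d) ->
  exists phi psi : StepFun a (a + INR N * d),
    (forall t, a <= t <= a + INR N * d -> Rabs (G t - phi t) <= psi t) /\
    RiemannInt_SF psi = d * (P (a + INR N * d) - P a).
Proof.
  intros hd. induction N as [|N IH]; intros hG.
  - simpl in *. replace (a + 0 * d) with a in * by ring.
    exists (mkStepFun (StepFun_P4 a a (G a))), (mkStepFun (StepFun_P4 a a 0)).
    split.
    + intros t ht. simpl. unfold fct_cte. replace t with a by lra.
      rewrite Rminus_diag, Rabs_R0. lra.
    + rewrite StepFun_P18. ring.
  - set (b := a + INR N * d) in *.
    assert (hc : a + INR (S N) * d = b + d) by (unfold b; rewrite S_INR; ring).
    rewrite hc in *.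
    assert (hab : a <= b).
    { unfold b. pose proof (Rmult_le_pos _ _ (pos_INR N) hd). lra. }
    destruct IH as [phi [psi [h1 h2]]].
    { intros x y hx hxy hy. apply hG; lra. }
    destruct (StepFun_extend a b (b + d) (G b) phi) as [phi' [q1 [q2 _]]]; try lra.
    destruct (StepFun_extend a b (b + d) (P (b + d) - P b) psi)
      as [psi' [r1 [r2 r3]]]; try lra.
    exists phi', psi'. split.
    + intros t ht. destruct (Rle_lt_dec t b) as [htb|htb].
      * rewrite q1, r1 by lra. apply h1. lra.
      * rewrite q2, r2 by lra. rewrite Rabs_minus_sym.
        apply Rle_trans with (P t - P b); [apply hG; lra|].
        (* [P] is nondecreasing, since its increments bound absolute values. *)
        pose proof (hG t (b + d)). pose proof (Rabs_pos (G t - G (b + d))). lra.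
    + rewrite r3, h2. ring.
Qed.

(** With [N] equal cells the step approximation has error [(b - a) * (P b - P a) / N], which is
    below [eps] for large [N]. *)
Lemma ex_RInt_var_bound (G P : R -> R) (a b : R) :
  a <= b -> var_bound G P a b -> ex_RInt G a b.
Proof.
  intros hab hG. apply ex_RInt_Reals_1. intros eps.
  assert (H : exists phi psi : StepFun a b,
    (forall t, a <= t <= b -> Rabs (G t - phi t) <= psi t) /\
    Rabs (RiemannInt_SF psi) < eps).
  { assert (hP : 0 <= P b - P a).
    { apply Rle_trans with (2 := hG a b ltac:(lra) hab ltac:(lra)). apply Rabs_pos. }
    assert (hb : 0 <= (b - a) * (P b - P a)) by (apply Rmult_le_pos; lra).
    pose proof (cond_pos eps) as he.
    destruct (INR_unbounded ((b - a) * (P b - P a) / eps)) as [N hN].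
    apply (Rmult_gt_compat_r eps) in hN; [|lra].
    replace ((b - a) * (P b - P a) / eps * eps) with ((b - a) * (P b - P a)) in hN
      by (field; lra).
    assert (hN0 : 0 < INR N) by (destruct (Rlt_le_dec 0 (INR N)); auto; nra).
    set (d := (b - a) / INR N).
    assert (hd : 0 <= d) by (apply Rdiv_le_0_compat; lra).
    assert (e : a + INR N * d = b) by (unfold d; field; lra).
    destruct (var_bound_step G P a d N hd) as [phi [psi [h1 h2]]].
    { now rewrite e. }
    revert phi psi h1 h2. rewrite e. intros phi psi h1 h2.
    exists phi, psi. split; auto. rewrite h2.
    rewrite Rabs_pos_eq by (apply Rmult_le_pos; lra).
    unfold d. apply Rmult_lt_reg_r with (INR N); auto.
    replace ((b - a) / INR N * (P b - P a) * INR N) with ((b - a) * (P b - P a))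
      by (field; lra). lra. }
  (* [Riemann_integrable] asks for the step functions as data; choice extracts them from the
     existence in [Prop]. *)
  apply constructive_indefinite_description in H. destruct H as [phi H].
  apply constructive_indefinite_description in H. destruct H as [psi H].
  exists phi, psi. rewrite (Rmin_left _ _ hab), (Rmax_right _ _ hab). exact H.
Qed.

Lemma RInt_lin_comb (f g : R -> R) (a b l m : R) :
  ex_RInt f a b -> ex_RInt g a b ->
  ex_RInt (fun t => l * f t + m * g t) a b /\
  RInt (fun t => l * f t + m * g t) a b = l * RInt f a b + m * RInt g a b.
Proof.
  intros hf hg.
  pose proof (ex_RInt_scal (V := R_CompleteNormedModule) f a b l hf) as hf'.
  pose proof (ex_RInt_scal (V := R_CompleteNormedModule) g a b m hg) as hg'.
  split.
  - exact (ex_RInt_plus (V := R_CompleteNormedModule) _ _ a b hf' hg').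
  - pose proof (RInt_plus (V := R_CompleteNormedModule) _ _ a b hf' hg') as e.
    rewrite !(RInt_scal (V := R_CompleteNormedModule)) in e by auto. exact e.
Qed.

Lemma RInt_cell (G : R -> R) (a b v e : R) :
  a <= b -> ex_RInt G a b -> (forall t, a <= t <= b -> Rabs (G t - v) <= e) ->
  Rabs (RInt G a b - (b - a) * v) <= (b - a) * e.
Proof.
  intros hab hG h.
  assert (e0 : RInt (fun t => G t - v) a b = RInt G a b - (b - a) * v).
  { pose proof (RInt_minus (V := R_CompleteNormedModule) G (fun _ => v) a b hG
                  (ex_RInt_const a b v)) as h0.
    rewrite RInt_const in h0. exact h0. }
  rewrite <- e0. apply abs_RInt_le_const; auto.
  exact (ex_RInt_minus (V := R_CompleteNormedModule) G (fun _ => v) a b hG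
           (ex_RInt_const a b v)).
Qed.

(** On each cell [G] differs from its value at the left end by at most the increment of [P], and
    these increments telescope. The sum up to [N] has [S N] cells. *)
Lemma RInt_Riemann_sum (G P : R -> R) (d : R) (N : nat) :
  0 <= d -> var_bound G P 0 (INR (S N) * d) ->
  Rabs (RInt G 0 (INR (S N) * d) - d * sum_f_R0 (fun j => G (INR j * d)) N)
    <= d * (P (INR (S N) * d) - P 0).
Proof.
  intros hd. induction N as [|N IH]; intros hG.
  - simpl in *. rewrite Rmult_0_l, Rmult_1_l in *.
    pose proof (RInt_cell G 0 d (G 0) (P d - P 0) hd) as h.
    rewrite Rminus_0_r in h. apply h.
    + apply ex_RInt_var_bound with P; auto.
    + intros t ht. rewrite Rabs_minus_sym.
      apply Rle_trans with (P t - P 0); [apply hG; lra|].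
      pose proof (hG t d). pose proof (Rabs_pos (G t - G d)). lra.
  - set (b := INR (S N) * d) in *.
    assert (hc : INR (S (S N)) * d = b + d) by (unfold b; rewrite (S_INR (S N)); ring).
    rewrite hc in *.
    assert (hb : 0 <= b) by (unfold b; pose proof (Rmult_le_pos _ _ (pos_INR (S N)) hd); lra).
    assert (hG1 : var_bound G P 0 b) by (intros x y ? ? ?; apply hG; lra).
    assert (hG2 : var_bound G P b (b + d)) by (intros x y ? ? ?; apply hG; lra).
    specialize (IH hG1).
    rewrite <- (RInt_Chasles G 0 b (b + d));
      try (apply ex_RInt_var_bound with P; auto; lra).
    rewrite tech5. fold b. change plus with Rplus.
    assert (h : Rabs (RInt G b (b + d) - (b + d - b) * G b) <= (b + d - b) * (P (b + d) - P b)).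
    { apply RInt_cell; [lra | apply ex_RInt_var_bound with P; auto; lra|].
      intros t ht. rewrite Rabs_minus_sym.
      apply Rle_trans with (P t - P b); [apply hG; lra|].
      pose proof (hG t (b + d)). pose proof (Rabs_pos (G t - G (b + d))). lra. }
    replace (b + d - b) with d in h by ring.
    match goal with |- Rabs ?x <= _ =>
      replace x with ((RInt G 0 b - d * sum_f_R0 (fun j => G (INR j * d)) N) +
                      (RInt G b (b + d) - d * G b)) by ring end.
    eapply Rle_trans; [apply Rabs_triang|]. lra.
Qed.

Lemma var_bound_mult (G H P Q : R -> R) (a b A B : R) :
  var_bound G P a b -> var_bound H Q a b ->
  (forall x, a <= x <= b -> Rabs (G x) <= A) ->
  (forall x, a <= x <= b -> Rabs (H x) <= B) ->
  var_bound (fun x => G x * H x) (fun x => A * Q x + B * P x) a b.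
Proof.
  intros hG hH hA hB x y hx hxy hy.
  replace (G x * H x - G y * H y) with (G x * (H x - H y) + H y * (G x - G y)) by ring.
  eapply Rle_trans; [apply Rabs_triang|]. rewrite !Rabs_mult.
  assert (h1 : Rabs (G x) * Rabs (H x - H y) <= A * (Q y - Q x)).
  { apply Rmult_le_compat; try apply Rabs_pos; [apply hA | apply hH]; lra. }
  assert (h2 : Rabs (H y) * Rabs (G x - G y) <= B * (P y - P x)).
  { apply Rmult_le_compat; try apply Rabs_pos; [apply hB | apply hG]; lra. }
  lra.
Qed.

(** * Bounded variation of convex functions of one variable *)

Definition convex_real (g : R -> R) (a b : R) : Prop :=
  forall x y l, a <= x <= b -> a <= y <= b -> 0 <= l <= 1 ->
    g (l * x + (1 - l) * y) <= l * g x + (1 - l) * g y.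

Lemma convex_real_le_max (g : R -> R) (a b x y z : R) :
  convex_real g a b -> a <= x -> x <= y -> y <= z -> z <= b -> g y <= Rmax (g x) (g z).
Proof.
  intros hg hx hxy hyz hz.
  destruct (Req_dec x z) as [e|e]. { replace y with x by lra. apply Rmax_l. }
  set (l := (z - y) / (z - x)).
  assert (hl : 0 <= l <= 1).
  { unfold l. split. { apply Rdiv_le_0_compat; lra. }
    apply Rmult_le_reg_r with (z - x); [lra|].
    unfold Rdiv. rewrite Rmult_assoc, Rinv_l by lra. lra. }
  pose proof (hg x z l ltac:(lra) ltac:(lra) hl) as h.
  replace (l * x + (1 - l) * z) with y in h by (unfold l; field; lra).
  pose proof (Rmax_l (g x) (g z)). pose proof (Rmax_r (g x) (g z)).
  apply Rle_trans with (1 := h).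
  set (m := Rmax (g x) (g z)) in *. nra.
Qed.

Lemma infimum_exists (E : R -> Prop) (B : R) :
  (exists y, E y) -> (forall y, E y -> - B <= y) ->
  exists d, (forall y, E y -> d <= y) /\ (forall e, (forall y, E y -> e <= y) -> e <= d).
Proof.
  intros [y0 hy0] hB.
  destruct (completeness (fun y => E (- y))) as [m [h1 h2]].
  - exists B. intros y hy. specialize (hB _ hy). lra.
  - exists (- y0). now rewrite Ropp_involutive.
  - exists (- m). split.
    + intros y hy. assert (- y <= m) by (apply h1; now rewrite Ropp_involutive). lra.
    + intros e he. assert (m <= - e); [|lra].
      apply h2. intros y hy. specialize (he _ hy). lra.
Qed.

(* With the running infimum [d u = inf { g v | a <= v <= u }], both [- d] and
   [g - d] are nondecreasing, because [g] first decreases and then increases. *)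
Lemma convex_var_bound (g : R -> R) (a b B : R) :
  a <= b -> convex_real g a b -> (forall x, a <= x <= b -> Rabs (g x) <= B) ->
  exists P, var_bound g P a b /\ P b - P a <= 6 * B.
Proof.
  intros hab hg hB.
  assert (hB' : forall x, a <= x <= b -> - B <= g x <= B).
  { intros x hx. apply Rabs_le_between. auto. }
  assert (ex : forall u, exists d, a <= u <= b ->
     (forall v, a <= v <= u -> d <= g v) /\
     (forall e, (forall v, a <= v <= u -> e <= g v) -> e <= d)).
  { intros u. destruct (classic (a <= u <= b)) as [hu|hu]; [|exists 0; tauto].
    destruct (infimum_exists (fun y => exists v, a <= v <= u /\ y = g v) B) as [d [h1 h2]].
    - exists (g a), a. split; auto; lra.
    - intros y [v [hv ->]]. apply hB'. lra.
    - exists d. intros _. split.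
      + intros v hv. apply h1. eauto.
      + intros e he. apply h2. intros y [v [hv ->]]. auto. }
  set (d := fun u => proj1_sig (constructive_indefinite_description _ (ex u))).
  assert (hd : forall u, a <= u <= b ->
     (forall v, a <= v <= u -> d u <= g v) /\
     (forall e, (forall v, a <= v <= u -> e <= g v) -> e <= d u)).
  { intros u. exact (proj2_sig (constructive_indefinite_description _ (ex u))). }
  clearbody d. clear ex.
  (* The sum of the nondecreasing functions [g - d] and [- d], whose difference is [g]. *)
  exists (fun u => g u - 2 * d u). split.
  - intros x y hx hxy hy.
    destruct (hd x ltac:(lra)) as [x1 x2]. destruct (hd y ltac:(lra)) as [y1 y2].
    assert (m1 : d y <= d x) by (apply x2; intros v hv; apply y1; lra).
    assert (m2 : g x - d x <= g y - d y).
    { assert (d y + g x - g y <= d x); [|lra].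
      apply x2. intros v hv.
      (* If [g x <= g v], then [d y <= g y] suffices. Otherwise convexity on the interval from [v]
         to [y] forces [g x <= g y], and [d y <= g v] suffices. *)
      destruct (Rle_lt_dec (g x) (g v)) as [c|c].
      - pose proof (y1 y). lra.
      - assert (h : g x <= Rmax (g v) (g y)).
        { apply convex_real_le_max with a b; auto; lra. }
        pose proof (y1 v ltac:(lra)).
        revert h. unfold Rmax. destruct (Rle_dec (g v) (g y)); lra. }
    apply Rabs_le_between. lra.
  - destruct (hd a ltac:(lra)) as [x1 x2]. destruct (hd b ltac:(lra)) as [y1 y2].
    pose proof (x1 a ltac:(lra)). pose proof (hB' a ltac:(lra)). pose proof (hB' b ltac:(lra)).
    assert (- B <= d b) by (apply y2; intros v hv; apply hB'; lra).
    lra.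
Qed.

(** * The total integral [Rint] and its scaling *)

Lemma Rint_RInt (f : R -> R) (a b : R) : ex_RInt f a b -> Rint f a b = RInt f a b.
Proof.
  intros h. unfold Rint.
  destruct (excluded_middle_informative (inhabited (Riemann_integrable f a b))) as [H|H].
  - symmetry. apply RInt_Reals.
  - exfalso. apply H. constructor. now apply ex_RInt_Reals_0.
Qed.

Lemma Rint_nonintegrable (f : R -> R) (a b : R) : ~ ex_RInt f a b -> Rint f a b = 0.
Proof.
  intros h. unfold Rint.
  destruct (excluded_middle_informative (inhabited (Riemann_integrable f a b))) as [[H]|H]; auto.
  exfalso. apply h. now apply ex_RInt_Reals_1.
Qed.

Lemma ex_RInt_scale (f : R -> R) (c k b : R) :
  ex_RInt f 0 (c * b) -> ex_RInt (fun t => k * f (c * t)) 0 b.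
Proof.
  intros h. destruct (Req_dec c 0) as [->|hc].
  { apply ex_RInt_ext with (fun _ => k * f 0).
    - intros t _. now rewrite Rmult_0_l.
    - apply ex_RInt_const. }
  apply ex_RInt_ext with (fun t => scal (k / c) (scal c (f (c * t + 0)))).
  - intros t _. rewrite Rplus_0_r. unfold scal; simpl; unfold mult; simpl. field. auto.
  - apply @ex_RInt_scal. apply @ex_RInt_comp_lin.
    now rewrite Rmult_0_r, !Rplus_0_r.
Qed.

(** No integrability is assumed: the scaling is invertible, so [f] and the scaled function are
    integrable together, and otherwise both sides are the default value 0. *)
Lemma Rint_scale (f : R -> R) (c k b : R) :
  c <> 0 -> k <> 0 -> Rint (fun t => k * f (c * t)) 0 b = k / c * Rint f 0 (c * b).
Proof.
  intros hc hk. destruct (classic (ex_RInt f 0 (c * b))) as [h|h].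
  - rewrite !Rint_RInt; auto using ex_RInt_scale.
    rewrite <- (Rmult_0_r c) at 2. rewrite <- (Rplus_0_r (c * 0)), <- (Rplus_0_r (c * b)).
    rewrite <- RInt_comp_lin by now rewrite Rmult_0_r, !Rplus_0_r.
    change (k / c * ?x) with (scal (k / c) x).
    rewrite <- RInt_scal.
    + apply RInt_ext. intros t _. rewrite Rplus_0_r.
      unfold scal; simpl; unfold mult; simpl. field. auto.
    + apply @ex_RInt_comp_lin. now rewrite Rmult_0_r, !Rplus_0_r.
  - rewrite (Rint_nonintegrable f); auto.
    rewrite Rint_nonintegrable; [ring|]. intros h'. apply h.
    apply ex_RInt_ext with (fun t => / k * (fun u => k * f (c * u)) (/ c * t)).
    + intros t _. simpl. rewrite <- Rmult_assoc, Rinv_l, Rmult_1_l by auto.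
      f_equal. field. auto.
    + apply (ex_RInt_scale (fun u => k * f (c * u)) (/ c) (/ k)).
      replace (/ c * (c * b)) with b by (field; auto). exact h'.
Qed.

(** * Iterated integrals of convex functions over a simplex *)

(** The bound on the sum of the coordinates is tested at the end of the list, where [s] has become
    the remaining slack; the length is forced to be [k]. *)
Fixpoint in_corner (k : nat) (s : R) (t : list R) : Prop :=
  match k, t with
  | O, nil => 0 <= s
  | S k', u :: t' => 0 <= u /\ in_corner k' (s - u) t'
  | _, _ => False
  end.

Fixpoint lcomb (l : R) (t t' : list R) : list R :=
  match t, t' with
  | a :: r, b :: r' => (l * a + (1 - l) * b) :: lcomb l r r'
  | _, _ => nil
  end.

Lemma in_corner_scale (k : nat) (c s : R) (t : list R) :
  0 <= c -> in_corner k s t -> in_corner k (c * s) (map (Rmult c) t).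
Proof.
  intros hc. revert s t.
  induction k as [|k IH]; intros s [|u t]; simpl; try tauto.
  - nra.
  - intros [hu ht]. split. { nra. }
    specialize (IH _ _ ht). now replace (c * s - c * u) with (c * (s - u)) by ring.
Qed.

Lemma map_lcomb (c l : R) (t t' : list R) :
  map (Rmult c) (lcomb l t t') = lcomb l (map (Rmult c) t) (map (Rmult c) t').
Proof.
  revert t'. induction t as [|u t IH]; intros [|u' t']; simpl; auto.
  rewrite IH. f_equal. ring.
Qed.

Definition convex_bounded (k : nat) (s B : R) (h : list R -> R) : Prop :=
  (forall t t' l, in_corner k s t -> in_corner k s t' -> 0 <= l <= 1 ->
     h (lcomb l t t') <= l * h t + (1 - l) * h t') /\
  (forall t, in_corner k s t -> Rabs (h t) <= B).

Lemma convex_bounded_slice (k : nat) (s B u : R) (h : list R -> R) :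
  0 <= u -> convex_bounded (S k) s B h ->
  convex_bounded k (s - u) B (fun t => h (u :: t)).
Proof.
  intros hu [hc hb]. split.
  - intros t t' l ht ht' hl.
    pose proof (hc (u :: t) (u :: t') l (conj hu ht) (conj hu ht') hl) as h0.
    simpl in h0. now replace (l * u + (1 - l) * u) with u in h0 by ring.
  - intros t ht. apply hb. now split.
Qed.

Lemma convex_bounded_scale (k : nat) (c B : R) (h : list R -> R) :
  0 <= c -> convex_bounded k c B h ->
  convex_bounded k 1 B (fun t => h (map (Rmult c) t)).
Proof.
  intros hc0 [hc hb].
  assert (hs : forall t, in_corner k 1 t -> in_corner k c (map (Rmult c) t)).
  { intros t ht. rewrite <- (Rmult_1_r c) at 1. now apply in_corner_scale. }
  split.
  - intros t t' l ht ht' hl. rewrite map_lcomb. apply hc; auto.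
  - auto.
Qed.

Lemma convex_bounded_const (k : nat) (s c : R) :
  convex_bounded k s (Rabs c) (fun _ => c).
Proof. split; intros; lra. Qed.

Lemma SI_scale (k : nat) (c s : R) (h : list R -> R) :
  c <> 0 -> SI k (c * s) h = c ^ k * SI k s (fun t => h (map (Rmult c) t)).
Proof.
  intros hc. revert s h. induction k as [|k IH]; intros s h; simpl. { ring. }
  assert (hk : c ^ k <> 0) by now apply pow_nonzero.
  (* The factor [/ c ^ k] is chosen to cancel the [c ^ k] that the inner integrals produce by
     induction. *)
  pose proof (Rint_scale (fun u => SI k (c * s - u) (fun t => h (u :: t)))
    c (/ c ^ k) s hc (Rinv_neq_0_compat _ hk)) as e.
  apply (f_equal (fun z => c * c ^ k * z)) in e.
  replace (c * c ^ k * (/ c ^ k / c * Rint (fun u => SI k (c * s - u) (fun t => h (u :: t))) 0 (c * s)))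
    with (Rint (fun u => SI k (c * s - u) (fun t => h (u :: t))) 0 (c * s)) in e
    by (field; auto).
  rewrite <- e. do 2 f_equal. apply functional_extensionality. intros v.
  replace (c * s - c * v) with (c * (s - v)) by ring.
  rewrite IH. field. auto.
Qed.

(** Includes [c = 0], because the slice of the simplex at [u = s] is degenerate. *)
Lemma SI_homogeneous (k : nat) (c : R) (h : list R -> R) :
  SI k c h = c ^ k * SI k 1 (fun t => h (map (Rmult c) t)).
Proof.
  destruct (Req_dec c 0) as [->|hc].
  - destruct k as [|k]. { simpl. ring. }
    rewrite pow_i by lia. rewrite Rmult_0_l. simpl.
    rewrite Rint_RInt by apply ex_RInt_point.
    exact (RInt_point (V := R_CompleteNormedModule) 0 _).
  - rewrite <- SI_scale by auto. now rewrite Rmult_1_r.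
Qed.

(** Comparison with a linear combination is the form that yields convexity of slice integrals; the
    combination itself need not be convex. *)
Definition SI_monotone (k : nat) : Prop :=
  forall s B B2 B3 h h2 h3 a b, 0 <= s <= 1 ->
    convex_bounded k s B h -> convex_bounded k s B2 h2 -> convex_bounded k s B3 h3 ->
    (forall t, in_corner k s t -> h t <= a * h2 t + b * h3 t) ->
    SI k s h <= a * SI k s h2 + b * SI k s h3.

Definition SI_bounded (k : nat) : Prop :=
  forall s B h, 0 <= s <= 1 -> convex_bounded k s B h -> Rabs (SI k s h) <= B.

(* Rescaling the slices to the unit simplex turns the slice integral into
   [(s - u) ^ k] times a function that is convex in [u]. *)
Lemma SI_slice_var_bound (k : nat) (s B : R) (h : list R -> R) :
  SI_monotone k -> SI_bounded k -> 0 <= s <= 1 -> convex_bounded (S k) s B h ->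
  exists P, var_bound (fun u => SI k (s - u) (fun t => h (u :: t))) P 0 s /\
    P s - P 0 <= 7 * B.
Proof.
  intros hm hbd hs hh.
  set (q := fun u t => h (u :: map (Rmult (s - u)) t)).
  assert (hq : forall u, 0 <= u <= s -> convex_bounded k 1 B (q u)).
  { intros u hu. apply (convex_bounded_scale k (s - u) B (fun t => h (u :: t))); [lra|].
    apply convex_bounded_slice; auto; lra. }
  assert (hgB : forall u, 0 <= u <= s -> Rabs (SI k 1 (q u)) <= B).
  { intros u hu. apply hbd; [lra | auto]. }
  assert (hB : 0 <= B).
  { apply Rle_trans with (2 := hgB 0 ltac:(lra)). apply Rabs_pos. }
  (* For fixed [t] the point [u :: map (Rmult (s - u)) t] is affine in [u], so [q u t] is convex in
     [u]; [hm] carries this over to the integrals. *)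
  assert (hconv : convex_real (fun u => SI k 1 (q u)) 0 s).
  { intros x y l hx hy hl.
    assert (hxy : 0 <= l * x + (1 - l) * y <= s) by nra.
    apply hm with B B B; auto; [lra|].
    intros t ht. unfold q. destruct hh as [hc _].
    assert (hin : forall u, 0 <= u <= s ->
              in_corner (S k) s (u :: map (Rmult (s - u)) t)).
    { intros u hu. split; [lra|]. rewrite <- (Rmult_1_r (s - u)) at 1.
      apply in_corner_scale; auto; lra. }
    pose proof (hc _ _ l (hin x hx) (hin y hy) hl) as h0. simpl in h0.
    apply Rle_trans with (2 := h0). right. do 2 f_equal. clear.
    induction t as [|a t IH]; simpl; auto. rewrite IH. f_equal. ring. }
  destruct (convex_var_bound _ 0 s B (proj1 hs) hconv hgB) as [P [hP1 hP2]].
  assert (hpow : forall x y, 0 <= x -> x <= y -> y <= s -> (s - y) ^ k <= (s - x) ^ k).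
  { intros x y hx hxy hy. apply pow_incr. lra. }
  assert (hv : var_bound (fun u => (s - u) ^ k) (fun u => - (s - u) ^ k) 0 s).
  { intros x y hx hxy hy. pose proof (hpow x y hx hxy hy).
    rewrite Rabs_pos_eq; lra. }
  assert (hk1 : forall x, 0 <= x <= s -> 0 <= (s - x) ^ k <= 1).
  { intros x hx. split. { apply pow_le. lra. }
    rewrite <- (pow1 k). apply pow_incr. lra. }
  (* The product rule with bounds [1] for the power and [B] for the convex factor; the total
     increment is at most [6 * B + B]. *)
  exists (fun u => 1 * P u + B * (- (s - u) ^ k)). split.
  - replace (fun u => SI k (s - u) (fun t => h (u :: t)))
      with (fun u => (s - u) ^ k * SI k 1 (q u)).
    + apply var_bound_mult; auto.
      intros x hx. rewrite Rabs_pos_eq; apply hk1; auto.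
    + apply functional_extensionality. intros u. symmetry. apply SI_homogeneous.
  - pose proof (hk1 0 ltac:(lra)). pose proof (hk1 s ltac:(lra)). nra.
Qed.

(** One induction serves both claims: integrability of the slice integrals in dimension [S k] rests
    on both of them in dimension [k]. *)
Lemma SI_monotone_bounded (k : nat) : SI_monotone k /\ SI_bounded k.
Proof.
  induction k as [|k [hm hb]].
  - split.
    + intros s B B2 B3 h h2 h3 a b hs _ _ _ hle. simpl. apply hle. simpl. lra.
    + intros s B h hs [_ hB]. simpl. apply hB. simpl. lra.
  - assert (hI : forall s B h, 0 <= s <= 1 -> convex_bounded (S k) s B h ->
      ex_RInt (fun u => SI k (s - u) (fun t => h (u :: t))) 0 s).
    { intros s B h hs hh.
      destruct (SI_slice_var_bound k s B h hm hb hs hh) as [P [hP _]].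
      apply ex_RInt_var_bound with P; auto; lra. }
    split.
    + intros s B B2 B3 h h2 h3 a b hs hh hh2 hh3 hle. simpl.
      pose proof (hI s B h hs hh) as i1.
      pose proof (hI s B2 h2 hs hh2) as i2.
      pose proof (hI s B3 h3 hs hh3) as i3.
      rewrite !Rint_RInt; auto.
      destruct (RInt_lin_comb _ _ 0 s a b i2 i3) as [i4 e].
      rewrite <- e. apply RInt_le; auto; [lra|].
      intros u hu. apply (hm (s - u) B B2 B3); try lra;
        try (apply convex_bounded_slice; auto; lra).
      intros t ht. apply hle. split; auto; lra.
    + intros s B h hs hh. simpl. rewrite Rint_RInt by eauto.
      assert (hB : 0 <= B).
      { specialize (hb s B (fun t => h (0 :: t)) hs). pose proof (Rabs_pos (SI k s (fun t => h (0 :: t)))).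
        pose proof (convex_bounded_slice k s B 0 h (Rle_refl 0) hh) as h0.
        rewrite Rminus_0_r in h0. specialize (hb h0). lra. }
      apply Rle_trans with ((s - 0) * B); [|nra].
      apply abs_RInt_le_const; eauto; [lra|].
      intros u hu. apply hb; [lra|]. apply convex_bounded_slice; auto; lra.
Qed.

(* Sum of [h] over the points of the grid [d * nat^k] with [t_1 + ... + t_k <= M * d]. *)
Fixpoint grid_sum (k M : nat) (d : R) (h : list R -> R) : R :=
  match k with
  | O => h nil
  | S k' => sum_f_R0 (fun j => grid_sum k' (M - j) d (fun t => h (INR j * d :: t))) M
  end.

Lemma sum_f_R0_minus_abs (a b : nat -> R) (e : R) (N : nat) :
  (forall j, (j <= N)%nat -> Rabs (a j - b j) <= e) ->
  Rabs (sum_f_R0 a N - sum_f_R0 b N) <= INR (S N) * e.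
Proof.
  intros h. rewrite <- minus_sum.
  eapply Rle_trans; [apply Rsum_abs|].
  rewrite Rmult_comm, <- sum_cte. apply sum_Rle. auto.
Qed.

(** Replacing the inner sums by slice integrals costs [c * B * d] for each of [M + 1] slices of
    weight [d], and [(M + 1) * d <= 2]; replacing the outer sum by an integral costs [8 * B * d].
    The constant depends on [k] alone, so the induction hypothesis is uniform over the slices. *)
Lemma grid_sum_SI (k : nat) :
  exists c, 0 <= c /\ forall M d B h, 0 < d <= 1 -> INR M * d <= 1 ->
    convex_bounded k (INR M * d) B h ->
    Rabs (d ^ k * grid_sum k M d h - SI k (INR M * d) h) <= c * B * d.
Proof.
  induction k as [|k [c [hc IH]]].
  - exists 0. split; [lra|]. intros M d B h _ _ _. simpl.
    replace (1 * h nil - h nil) with 0 by ring. rewrite Rabs_R0. lra.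
  - destruct (SI_monotone_bounded k) as [hm hb].
    exists (2 * c + 8). split; [lra|]. intros M d B h hd hMd hh.
    set (s := INR M * d) in *.
    assert (hs : 0 <= s <= 1).
    { unfold s in *. pose proof (pos_INR M). nra. }
    set (G := fun u => SI k (s - u) (fun t => h (u :: t))).
    destruct (SI_slice_var_bound k s B h hm hb hs hh) as [P [hP1 hP2]].
    assert (hG : forall u, 0 <= u <= s -> Rabs (G u) <= B).
    { intros u hu. apply hb; [lra|]. apply convex_bounded_slice; auto; lra. }
    assert (hB : 0 <= B).
    { apply Rle_trans with (2 := hG 0 ltac:(lra)). apply Rabs_pos. }
    assert (hj : forall j, (j <= M)%nat -> 0 <= INR j * d <= s).
    { intros j hj. pose proof (pos_INR j). apply le_INR in hj. unfold s. nra. }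
    assert (e1 : Rabs (d * sum_f_R0 (fun j => d ^ k * grid_sum k (M - j) d
                         (fun t => h (INR j * d :: t))) M
                  - d * sum_f_R0 (fun j => G (INR j * d)) M) <= 2 * c * B * d).
    { rewrite <- Rmult_minus_distr_l, Rabs_mult, (Rabs_pos_eq d) by lra.
      apply Rle_trans with (d * (INR (S M) * (c * B * d))).
      - apply Rmult_le_compat_l; [lra|]. apply sum_f_R0_minus_abs. intros j hjM.
        unfold G. specialize (hj j hjM).
        replace (s - INR j * d) with (INR (M - j) * d)
          by (rewrite minus_INR by auto; unfold s; ring).
        assert (e : INR (M - j) * d = s - INR j * d)
          by (rewrite minus_INR by auto; unfold s; ring).
        apply IH; auto; rewrite e; [lra|].
        apply convex_bounded_slice; auto; lra.
      - rewrite S_INR. unfold s in hMd.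
        replace (d * ((INR M + 1) * (c * B * d))) with ((INR M * d + d) * (c * B * d)) by ring.
        replace (2 * c * B * d) with (2 * (c * B * d)) by ring.
        apply Rmult_le_compat_r; [|lra].
        repeat apply Rmult_le_pos; lra. }
    assert (e2 : Rabs (d * sum_f_R0 (fun j => G (INR j * d)) M - RInt G 0 s) <= 8 * B * d).
    { destruct M as [|M].
      - unfold s. simpl. rewrite Rmult_0_l, RInt_point.
        change (@zero R_CompleteNormedModule) with 0.
        rewrite Rminus_0_r, Rabs_mult, (Rabs_pos_eq d) by lra.
        specialize (hG 0 ltac:(lra)). nra.
      (* The grid contains [u = s], one term more than the Riemann sum; this raises the [7 * B] of
         the variation to [8 * B]. *)
      - rewrite tech5. fold s.
        pose proof (RInt_Riemann_sum G P d M ltac:(lra) hP1) as h1. fold s in h1.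
        pose proof (hG s ltac:(lra)) as h2.
        rewrite Rabs_minus_sym in h1.
        replace (d * (sum_f_R0 (fun j => G (INR j * d)) M + G s) - RInt G 0 s)
          with ((d * sum_f_R0 (fun j => G (INR j * d)) M - RInt G 0 s) + d * G s) by ring.
        eapply Rle_trans; [apply Rabs_triang|].
        rewrite (Rabs_mult d), (Rabs_pos_eq d) by lra. nra. }
    assert (e3 : SI (S k) s h = RInt G 0 s).
    { simpl. apply Rint_RInt. apply ex_RInt_var_bound with P; auto; lra. }
    rewrite e3. simpl grid_sum.
    replace (d ^ S k * sum_f_R0 (fun j => grid_sum k (M - j) d (fun t => h (INR j * d :: t))) M)
      with (d * sum_f_R0 (fun j => d ^ k * grid_sum k (M - j) d
                         (fun t => h (INR j * d :: t))) M).
    + match goal with |- Rabs (?x - ?z) <= _ =>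
        replace (x - z) with ((x - d * sum_f_R0 (fun j => G (INR j * d)) M) +
                              (d * sum_f_R0 (fun j => G (INR j * d)) M - z)) by ring end.
      eapply Rle_trans; [apply Rabs_triang|]. lra.
    + simpl. rewrite Rmult_assoc. f_equal. rewrite scal_sum. apply sum_eq.
      intros. ring.
Qed.

(** * Sums over weak compositions *)

Definition point : Type := nat -> R.
Definition padd (p q : point) : point := fun j => p j + q j.
Definition pscale (a : R) (p : point) : point := fun j => a * p j.
Definition pzero : point := fun _ => 0.

Lemma sum_f_R0_rev (a : nat -> R) (m : nat) :
  sum_f_R0 a m = sum_f_R0 (fun i => a (m - i)%nat) m.
Proof.
  revert a. induction m as [|m IH]; intros a; auto.
  rewrite (decomp_sum a (S m)) by lia. rewrite tech5, Nat.sub_diag. simpl pred.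
  rewrite (IH (fun i => a (S i))), Rplus_comm. f_equal.
  apply sum_eq. intros i hi. f_equal. lia.
Qed.

Lemma sum_triangle_diag (a : nat -> nat -> R) (m : nat) :
  sum_f_R0 (fun i => sum_f_R0 (fun j => a i j) (m - i)) m =
  sum_f_R0 (fun s => sum_f_R0 (fun i => a i (s - i)%nat) s) m.
Proof.
  induction m as [|m IH]; auto.
  rewrite !tech5, <- IH, Nat.sub_diag.
  rewrite (sum_eq _ (fun i => sum_f_R0 (fun j => a i j) (m - i) + a i (S m - i)%nat) m).
  - rewrite sum_plus. simpl. ring.
  - intros i hi. replace (S m - i)%nat with (S (m - i)) by lia. apply tech5.
Qed.

Lemma sum_triangle_swap (a : nat -> nat -> R) (m : nat) :
  sum_f_R0 (fun i => sum_f_R0 (fun j => a i j) (m - i)) m =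
  sum_f_R0 (fun j => sum_f_R0 (fun i => a i j) (m - j)) m.
Proof.
  rewrite sum_triangle_diag, (sum_triangle_diag (fun j i => a i j)).
  apply sum_eq. intros s _. rewrite sum_f_R0_rev. apply sum_eq.
  intros i hi. do 2 f_equal. lia.
Qed.

Lemma sum_f_R0_lin_comb (a b : nat -> R) (l k : R) (m : nat) :
  sum_f_R0 (fun i => l * a i + k * b i) m = l * sum_f_R0 a m + k * sum_f_R0 b m.
Proof.
  rewrite sum_plus, !scal_sum. f_equal; apply sum_eq; intros; ring.
Qed.

(* Sum of [g (sum_i a_i v_i)] over all natural weights [a_i] with [sum_i a_i = m]. *)
Fixpoint comp_sum (vs : list point) (m : nat) (g : point -> R) : R :=
  match vs with
  | nil => match m with O => g pzero | S _ => 0 end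
  | v :: vs' =>
      sum_f_R0 (fun i => comp_sum vs' (m - i) (fun p => g (padd (pscale (INR i) v) p))) m
  end.

(** The binomial coefficient of [m + k - 1] over [k - 1] when [k >= 1], in a recursive form that
    follows [comp_sum]. *)
Fixpoint comp_count (k m : nat) : R :=
  match k with
  | O => match m with O => 1 | S _ => 0 end
  | S k' => sum_f_R0 (fun i => comp_count k' (m - i)) m
  end.

Lemma comp_sum_lin_comb (vs : list point) (m : nat) (g h : point -> R) (l k : R) :
  comp_sum vs m (fun p => l * g p + k * h p) = l * comp_sum vs m g + k * comp_sum vs m h.
Proof.
  revert m g h. induction vs as [|v vs IH]; intros m g h; simpl.
  - destruct m; ring.
  - rewrite <- sum_f_R0_lin_comb. apply sum_eq. intros i _. apply IH.
Qed.

Lemma comp_sum_one (vs : list point) (m : nat) :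
  comp_sum vs m (fun _ => 1) = comp_count (length vs) m.
Proof.
  revert m. induction vs as [|v vs IH]; intros m; simpl; auto.
  apply sum_eq. auto.
Qed.

Lemma comp_sum_scal_add (vs : list point) (m : nat) (g : point -> R) (l k : R) :
  comp_sum vs m (fun p => l * g p + k) =
  l * comp_sum vs m g + comp_count (length vs) m * k.
Proof.
  rewrite <- (comp_sum_one vs m).
  transitivity (comp_sum vs m (fun p => l * g p + k * (fun _ => 1) p)).
  - f_equal. apply functional_extensionality. intros p. ring.
  - rewrite comp_sum_lin_comb. ring.
Qed.

(** Transposing two neighbouring vertices exchanges the order of a double sum over a triangle of
    weights. *)
Lemma comp_sum_perm (vs ws : list point) :
  Permutation vs ws -> forall m g, comp_sum vs m g = comp_sum ws m g.
Proof.
  induction 1 as [|v vs ws _ IH|v w vs|us vs ws _ IH1 _ IH2]; intros m g; simpl; auto.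
  - apply sum_eq. auto.
  - rewrite sum_triangle_swap. apply sum_eq. intros i _. apply sum_eq. intros j _.
    f_equal.
    + lia.
    + apply functional_extensionality. intros p. f_equal.
      apply functional_extensionality. intros n. unfold padd. ring.
  - now rewrite IH1.
Qed.

(** Compositions are sorted by their total weight [j] on [vs]; the induction regroups the weight of
    the head and that of the tail along diagonals. *)
Lemma comp_sum_app (vs ws : list point) (m : nat) (g : point -> R) :
  comp_sum (vs ++ ws) m g =
  sum_f_R0 (fun j => comp_sum vs j (fun p => comp_sum ws (m - j) (fun q => g (padd p q)))) m.
Proof.
  revert m g. induction vs as [|v vs IH]; intros m g; simpl.
  - assert (e : (fun q => g (padd pzero q)) = g).
    { apply functional_extensionality. intros q. f_equal.
      apply functional_extensionality. intros n. unfold padd, pzero. ring. }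
    rewrite e. destruct m as [|m]; auto.
    rewrite decomp_sum by lia. simpl.
    rewrite sum_eq_R0 by auto. ring.
  - rewrite (sum_eq _ (fun i => sum_f_R0 (fun j => comp_sum vs j (fun p =>
        comp_sum ws (m - (i + j)) (fun q => g (padd (padd (pscale (INR i) v) p) q)))) (m - i)) m).
    + rewrite (sum_triangle_diag (fun i j => comp_sum vs j (fun p =>
        comp_sum ws (m - (i + j)) (fun q => g (padd (padd (pscale (INR i) v) p) q))))).
      apply sum_eq. intros s hs. apply sum_eq. intros i hi.
      f_equal. apply functional_extensionality. intros p.
      now replace (m - (i + (s - i)))%nat with (m - s)%nat by lia.
    + intros i hi. rewrite IH. apply sum_eq. intros j hj. f_equal.
      apply functional_extensionality. intros p.
      replace (m - i - j)%nat with (m - (i + j))%nat by lia. f_equal.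
      apply functional_extensionality. intros q. f_equal.
      apply functional_extensionality. intros n. unfold padd. ring.
Qed.

(** * Counting weak compositions *)

Lemma comp_count_conv (a b m : nat) :
  sum_f_R0 (fun j => comp_count a j * comp_count b (m - j)) m = comp_count (a + b) m.
Proof.
  (* Vandermonde convolution by counting: summing the constant 1 over dummy vertices reduces it to
     [comp_sum_app]. *)
  transitivity (comp_count (length (repeat pzero a ++ repeat pzero b)) m);
    [|now rewrite length_app, !repeat_length].
  rewrite <- comp_sum_one, comp_sum_app.
  apply sum_eq. intros j _.
  rewrite (comp_sum_one (repeat pzero b)), repeat_length.
  transitivity (comp_sum (repeat pzero a) j
                  (fun p => 0 * (fun _ => 1) p + comp_count b (m - j))).
  - rewrite comp_sum_scal_add, repeat_length. ring.
  - f_equal. apply functional_extensionality. intros. ring.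
Qed.

Lemma comp_count_S (k m : nat) : comp_count (S k) m = sum_f_R0 (comp_count k) m.
Proof. symmetry. apply sum_f_R0_rev. Qed.

Lemma comp_count_S_S (k m : nat) :
  comp_count (S k) (S m) = comp_count (S k) m + comp_count k (S m).
Proof. rewrite !comp_count_S. apply tech5. Qed.

Lemma comp_count_0_r (k : nat) : comp_count k 0 = 1.
Proof. induction k; simpl; auto. Qed.

(** Absorption identities for binomial coefficients, proved jointly: the second for [S k] follows
    from both for [k], and then gives the first for [S k] by induction on [m]. *)
Lemma comp_count_shift (k m : nat) :
  INR k * comp_count (S k) m = (INR m + INR k) * comp_count k m /\
  INR (S m) * comp_count k (S m) = (INR m + INR k) * comp_count k m.
Proof.
  revert m. induction k as [|k IH]; intros m.
  - simpl comp_count at 2 3 4. destruct m; simpl INR; lra.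
  - assert (Q : forall m, INR (S m) * comp_count (S k) (S m) =
                          (INR m + INR (S k)) * comp_count (S k) m).
    { intros i. rewrite comp_count_S_S. destruct (IH i) as [h1 h2].
      rewrite Rmult_plus_distr_l, h2, <- h1, !S_INR. ring. }
    split; auto. induction m as [|m IHm].
    + rewrite !comp_count_0_r. simpl. ring.
    + rewrite comp_count_S_S, Rmult_plus_distr_l, IHm, <- Q, !S_INR. ring.
Qed.

Lemma comp_count_succ (k m : nat) :
  INR (S m) * comp_count k (S m) = INR k * comp_count (S k) m.
Proof. destruct (comp_count_shift k m). lra. Qed.

Lemma comp_count_nonneg (k m : nat) : 0 <= comp_count k m.
Proof.
  revert m. induction k as [|k IH]; intros m; simpl.
  - destruct m; lra.
  - apply cond_pos_sum. auto.
Qed.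

Lemma sum_f_R0_le_const (a : nat -> R) (c : R) (m : nat) :
  (forall i, (i <= m)%nat -> a i <= c) -> sum_f_R0 a m <= INR (S m) * c.
Proof.
  intros h. rewrite Rmult_comm, <- sum_cte. now apply sum_Rle.
Qed.

Lemma comp_count_1 (m : nat) : comp_count 1 m = 1.
Proof.
  induction m as [|m IH]; [reflexivity|].
  rewrite comp_count_S_S, IH. simpl. ring.
Qed.

Lemma comp_count_le (k m : nat) : comp_count (S k) m <= INR (S m) ^ k.
Proof.
  revert m. induction k as [|k IH]; intros m.
  - rewrite comp_count_1. simpl. lra.
  - change (comp_count (S (S k)) m) with (sum_f_R0 (fun i => comp_count (S k) (m - i)) m).
    change (INR (S m) ^ S k) with (INR (S m) * INR (S m) ^ k).
    apply sum_f_R0_le_const. intros i hi.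
    apply Rle_trans with (1 := IH (m - i)%nat). apply pow_incr.
    split. { apply pos_INR. } apply le_INR. lia.
Qed.

(** The right side is the product of the [m + i] for [1 <= i <= k], each of them at least [m + 1].
    With [comp_count_le] this fixes the growth order [m ^ k]. *)
Lemma comp_count_ge (k m : nat) : INR (S m) ^ k <= INR (fact k) * comp_count (S k) m.
Proof.
  induction k as [|k IH].
  - rewrite comp_count_1. simpl. lra.
  - change (fact (S k)) with (S k * fact k)%nat. rewrite mult_INR.
    destruct (comp_count_shift (S k) m) as [h _].
    replace (INR (S k) * INR (fact k) * comp_count (S (S k)) m)
      with (INR (fact k) * (INR (S k) * comp_count (S (S k)) m)) by ring.
    rewrite h.
    replace (INR (fact k) * ((INR m + INR (S k)) * comp_count (S k) m))
      with ((INR m + INR (S k)) * (INR (fact k) * comp_count (S k) m)) by ring.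
    change (INR (S m) ^ S k) with (INR (S m) * INR (S m) ^ k).
    apply Rmult_le_compat; auto.
    + apply pos_INR.
    + apply pow_le, pos_INR.
    + rewrite !S_INR. pose proof (pos_INR k). lra.
Qed.

Lemma comp_count_pos (k m : nat) : 0 < comp_count (S k) m.
Proof.
  pose proof (comp_count_ge k m). pose proof (INR_fact_lt_0 k).
  assert (0 < INR (S m) ^ k) by apply pow_lt, lt_0_INR, Nat.lt_0_succ.
  destruct (Rlt_le_dec 0 (comp_count (S k) m)); auto. nra.
Qed.

(** The term [j = 0] vanishes; in the others [comp_count_succ] absorbs the factor [j], which leaves
    a plain convolution for [S a] and [b] of total [m - 1]. *)
Lemma comp_count_mean (a b m : nat) :
  INR (a + b) * sum_f_R0 (fun j => INR j * comp_count a j * comp_count b (m - j)) m =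
  INR a * (INR m * comp_count (a + b) m).
Proof.
  destruct m as [|m]. { simpl. ring. }
  rewrite decomp_sum by lia. simpl pred. simpl INR at 2.
  rewrite (sum_eq _ (fun j => comp_count (S a) j * comp_count b (m - j) * INR a)).
  - rewrite <- (scal_sum (fun j => comp_count (S a) j * comp_count b (m - j))).
    rewrite comp_count_conv, (comp_count_succ (a + b) m). simpl Nat.add. ring.
  - intros j _. rewrite comp_count_succ. simpl Nat.sub. ring.
Qed.

(** * Convexity and perspectives *)

Definition convex_set (D : point -> Prop) : Prop :=
  forall p q t, D p -> D q -> 0 <= t <= 1 -> D (fun j => t * p j + (1 - t) * q j).

(** The dilate [c D], reduced to the origin at [c = 0]. A grid point of level [m], before division
    by [m], lies in [cone D (INR m)]. *)
Definition cone (D : point -> Prop) (c : R) (p : point) : Prop :=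
  (c = 0 /\ p = pzero) \/ (0 < c /\ D (pscale (/ c) p)).

Lemma padd_pzero_l (p : point) : padd pzero p = p.
Proof. apply functional_extensionality. intros j. unfold padd, pzero. ring. Qed.

Lemma padd_pzero_r (p : point) : padd p pzero = p.
Proof. apply functional_extensionality. intros j. unfold padd, pzero. ring. Qed.

Lemma pscale_padd_convex (c d : R) (p q : point) : 0 < c -> 0 < d ->
  pscale (/ (c + d)) (padd p q) =
  (fun j => c / (c + d) * pscale (/ c) p j + (1 - c / (c + d)) * pscale (/ d) q j).
Proof.
  intros hc hd. apply functional_extensionality. intros j. unfold pscale, padd.
  field. lra.
Qed.

Lemma weight_bounds (c d : R) : 0 < c -> 0 < d -> 0 <= c / (c + d) <= 1.
Proof.
  intros hc hd. split. { apply Rdiv_le_0_compat; lra. }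
  apply Rmult_le_reg_r with (c + d); [lra|].
  unfold Rdiv. rewrite Rmult_assoc, Rinv_l; lra.
Qed.

Lemma cone_padd (D : point -> Prop) (c d : R) (p q : point) :
  convex_set D -> cone D c p -> cone D d q -> cone D (c + d) (padd p q).
Proof.
  intros hD [[-> ->]|[hc hp]] hq.
  { now rewrite padd_pzero_l, Rplus_0_l. }
  destruct hq as [[-> ->]|[hd hq]].
  { rewrite padd_pzero_r, Rplus_0_r. now right. }
  right. split; [lra|]. rewrite pscale_padd_convex by auto.
  apply hD; auto. now apply weight_bounds.
Qed.

Lemma cone_pscale (D : point -> Prop) (c : R) (v : point) :
  0 <= c -> D v -> cone D c (pscale c v).
Proof.
  intros hc hv. destruct (Req_dec c 0) as [->|hc0].
  - left. split; auto. apply functional_extensionality. intros j.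
    unfold pscale, pzero. ring.
  - right. split; [lra|].
    replace (pscale (/ c) (pscale c v)) with v; auto.
    apply functional_extensionality. intros j. unfold pscale. field. auto.
Qed.

Lemma cone_1 (D : point -> Prop) (p : point) : cone D 1 p -> D p.
Proof.
  intros [[h _]|[_ h]]; [lra|].
  replace p with (pscale (/ 1) p); auto.
  apply functional_extensionality. intros j. unfold pscale. field.
Qed.

(* Jointly homogeneous in [(c, p)]; at [c = 0] it is [0] whatever [f (pscale (/ 0) p)] is. *)
Definition perspective (f : point -> R) (c : R) (p : point) : R :=
  c * f (pscale (/ c) p).

(** Convexity of [f] with weights [c / (c + d)] and [d / (c + d)], multiplied by [c + d]; if one
    level is 0, its point is the origin and its term vanishes. *)
Lemma perspective_subadditive (D : point -> Prop) (f : point -> R) (c d : R) (p q : point) :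
  convex_on D f -> cone D c p -> cone D d q ->
  perspective f (c + d) (padd p q) <= perspective f c p + perspective f d q.
Proof.
  intros hf [[-> ->]|[hc hp]] hq.
  { rewrite padd_pzero_l, Rplus_0_l. unfold perspective at 2. lra. }
  destruct hq as [[-> ->]|[hd hq]].
  { rewrite padd_pzero_r, Rplus_0_r. unfold perspective at 3. lra. }
  unfold perspective. rewrite pscale_padd_convex by auto.
  pose proof (hf _ _ _ hp hq (weight_bounds c d hc hd)) as h.
  apply (Rmult_le_compat_l (c + d)) in h; [|lra].
  apply Rle_trans with (1 := h). right. field. lra.
Qed.

(** Every point at which [comp_sum vs m] evaluates its summand lies in [cone D (INR m)]. *)
Lemma comp_sum_le (D : point -> Prop) (vs : list point) (m : nat) (g g' : point -> R) :
  convex_set D -> Forall D vs ->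
  (forall p, cone D (INR m) p -> g p <= g' p) -> comp_sum vs m g <= comp_sum vs m g'.
Proof.
  intros hD. revert m g g'. induction vs as [|v vs IH]; intros m g g' hvs hg; simpl.
  - destruct m; [|lra]. apply hg. left. auto.
  - inversion hvs; subst. apply sum_Rle. intros i hi. apply IH; auto.
    intros p hp. apply hg.
    replace (INR m) with (INR i + INR (m - i)) by (rewrite minus_INR by auto; ring).
    apply cone_padd; auto. apply cone_pscale; auto. apply pos_INR.
Qed.

(** Subadditivity separates the two halves of each grid point; a term depending on one half is
    constant in the sum over the other, hence the counts. *)
Lemma comp_sum_perspective_app (D : point -> Prop) (f : point -> R) (A B : list point) (m : nat) :
  convex_set D -> convex_on D f -> Forall D A -> Forall D B ->
  comp_sum (A ++ B) m (perspective f (INR m)) <=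
  sum_f_R0 (fun j =>
    comp_count (length B) (m - j) * comp_sum A j (perspective f (INR j)) +
    comp_count (length A) j * comp_sum B (m - j) (perspective f (INR (m - j)))) m.
Proof.
  intros hD hf hA hB. rewrite comp_sum_app. apply sum_Rle. intros j hj.
  rewrite <- comp_sum_scal_add.
  apply comp_sum_le with D; auto. intros p hp.
  apply Rle_trans with (comp_sum B (m - j) (fun q =>
    1 * perspective f (INR (m - j)) q + perspective f (INR j) p)).
  - apply comp_sum_le with D; auto. intros q hq.
    replace (INR m) with (INR j + INR (m - j)) by (rewrite minus_INR by auto; ring).
    apply Rle_trans with (1 := perspective_subadditive D f _ _ p q hf hp hq). lra.
  - rewrite (comp_sum_scal_add B (m - j) (perspective f (INR (m - j)))). lra.
Qed.

(** * Composition sums as grid sums, and their convergence to averages *)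

Definition pdiff (v0 w : point) : point := fun j => w j - v0 j.

(** [v0] stands last so that its weight is whatever the others leave over: total weight exactly [M]
    becomes coordinate sum at most [M]. The offset [q] collects the vertices already processed. *)
Lemma comp_sum_grid_sum (f : point -> R) (d : R) (v0 : point) (rest : list point)
    (M : nat) (q : point) :
  comp_sum (rest ++ v0 :: nil) M (fun p => f (padd q (pscale d p))) =
  grid_sum (length rest) M d
    (fun t => f (fun j => q j + INR M * d * v0 j + comb t (map (pdiff v0) rest) j)).
Proof.
  revert M q. induction rest as [|v rest IH]; intros M q; simpl.
  - destruct M as [|M].
    + simpl. f_equal. apply functional_extensionality. intros j.
      unfold padd, pscale, pzero. ring.
    + rewrite tech5, Nat.sub_diag, sum_eq_R0.
      * rewrite Rplus_0_l. f_equal. apply functional_extensionality. intros j.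
        unfold padd, pscale, pzero. ring.
      * intros i hi. now destruct (S M - i)%nat eqn:e; [lia|].
  - apply sum_eq. intros i hi.
    transitivity (comp_sum (rest ++ v0 :: nil) (M - i)
      (fun p => f (padd (padd q (pscale (INR i * d) v)) (pscale d p)))).
    + f_equal. apply functional_extensionality. intros p. f_equal.
      apply functional_extensionality. intros j. unfold padd, pscale. ring.
    + rewrite IH. f_equal. apply functional_extensionality. intros t. f_equal.
      apply functional_extensionality. intros j. unfold padd, pscale.
      unfold pdiff at 2. rewrite minus_INR by auto. ring.
Qed.

(** The corner conditions give both lists length [k], so [lcomb] truncates neither. *)
Lemma comb_lcomb (k : nat) (s s' l : R) (t t' : list R) (ws : list point) (j : nat) :
  in_corner k s t -> in_corner k s' t' ->
  comb (lcomb l t t') ws j = l * comb t ws j + (1 - l) * comb t' ws j.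
Proof.
  revert s s' t t' ws.
  induction k as [|k IH]; intros s s' [|u t] [|u' t'] ws; simpl; try tauto.
  - intros. ring.
  - intros [_ ht] [_ ht']. destruct ws as [|w ws]; [ring|].
    rewrite (IH _ _ _ _ ws ht ht'). ring.
Qed.

(** The point is a combination of the vertices with nonnegative weights of total [s], in which [v0]
    carries the slack. *)
Lemma in_corner_cone (D : point -> Prop) (v0 : point) (rest : list point) (s : R) (t : list R) :
  convex_set D -> D v0 -> Forall D rest -> in_corner (length rest) s t ->
  cone D s (fun j => s * v0 j + comb t (map (pdiff v0) rest) j).
Proof.
  intros hD h0. revert s t.
  induction rest as [|v rest IH]; intros s [|u t] hr; simpl; try tauto.
  - intros hs.
    replace (fun j => s * v0 j + 0) with (pscale s v0).
    + now apply cone_pscale.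
    + apply functional_extensionality. intros j. unfold pscale. ring.
  - intros [hu ht]. inversion hr; subst.
    replace (fun j => s * v0 j + (u * pdiff v0 v j + comb t (map (pdiff v0) rest) j))
      with (padd (pscale u v) (fun j => (s - u) * v0 j + comb t (map (pdiff v0) rest) j)).
    + replace s with (u + (s - u)) at 1 by ring.
      apply cone_padd; auto. now apply cone_pscale.
    + apply functional_extensionality. intros j. unfold padd, pscale, pdiff. ring.
Qed.

Lemma simplex_param_convex_bounded (D : point -> Prop) (f : point -> R) (B : R)
    (v0 : point) (rest : list point) :
  convex_set D -> convex_on D f -> (forall p, D p -> Rabs (f p) <= B) ->
  D v0 -> Forall D rest ->
  convex_bounded (length rest) 1 B
    (fun t => f (fun j => v0 j + comb t (map (pdiff v0) rest) j)).
Proof.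
  intros hD hf hB h0 hr.
  assert (hin : forall t, in_corner (length rest) 1 t ->
            D (fun j => v0 j + comb t (map (pdiff v0) rest) j)).
  { intros t ht. apply cone_1.
    pose proof (in_corner_cone D v0 rest 1 t hD h0 hr ht) as h.
    replace (fun j => v0 j + comb t (map (pdiff v0) rest) j)
      with (fun j => 1 * v0 j + comb t (map (pdiff v0) rest) j); auto.
    apply functional_extensionality. intros j. ring. }
  split.
  - intros t t' l ht ht' hl.
    apply Rle_trans with (2 := hf _ _ l (hin t ht) (hin t' ht') hl). right. f_equal.
    apply functional_extensionality. intros j.
    rewrite (comb_lcomb _ _ _ l _ _ _ j ht ht'). ring.
  - intros t ht. apply hB. auto.
Qed.

Lemma grid_sum_one (k M : nat) (d : R) : grid_sum k M d (fun _ => 1) = comp_count (S k) M.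
Proof.
  revert M. induction k as [|k IH]; intros M.
  - simpl grid_sum. now rewrite comp_count_1.
  - change (comp_count (S (S k)) M) with (sum_f_R0 (fun i => comp_count (S k) (M - i)) M).
    simpl grid_sum. apply sum_eq. auto.
Qed.

Lemma grid_sum_one_SI (k : nat) :
  exists c, forall m,
    Rabs ((/ INR (S m)) ^ k * comp_count (S k) (S m) - SI k 1 (fun _ => 1)) <= c * / INR (S m).
Proof.
  destruct (grid_sum_SI k) as [c [hc h]]. exists c. intros m.
  assert (h1 : 1 <= INR (S m)) by (rewrite S_INR; pose proof (pos_INR m); lra).
  assert (e : INR (S m) * / INR (S m) = 1) by (field; lra).
  assert (h2 : 0 < / INR (S m) <= 1).
  { split. { apply Rinv_0_lt_compat. lra. } rewrite <- Rinv_1. apply Rinv_le_contravar; lra. }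
  specialize (h (S m) (/ INR (S m)) 1 (fun _ => 1) h2). rewrite e in h.
  rewrite grid_sum_one, Rmult_1_r in h. apply h; [lra|].
  pose proof (convex_bounded_const k 1 1) as h3. now rewrite Rabs_R1 in h3.
Qed.

(** Archimedean form of the passage to the limit in [m]. *)
Lemma INR_bounded_nonpos (a b : R) : (forall m, INR (S m) * a <= b) -> a <= 0.
Proof.
  intros h. destruct (Rle_lt_dec a 0) as [|ha]; auto.
  destruct (INR_unbounded (b / a)) as [m hm].
  specialize (h m). rewrite S_INR in h.
  apply (Rmult_gt_compat_r a) in hm; auto.
  replace (b / a * a) with b in hm by (field; lra). lra.
Qed.

(** By [comp_count_ge] the normalised grid counts stay above [/ INR (fact k)], hence so does their
    limit; the iterated integral is never evaluated. *)
Lemma SI_one_pos (k : nat) : 0 < SI k 1 (fun _ => 1).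
Proof.
  destruct (grid_sum_one_SI k) as [c h].
  pose proof (INR_fact_lt_0 k) as hf.
  apply Rlt_le_trans with (/ INR (fact k)); [now apply Rinv_0_lt_compat|].
  assert (/ INR (fact k) - SI k 1 (fun _ => 1) <= 0); [|lra].
  apply INR_bounded_nonpos with c. intros m. specialize (h m).
  assert (hm : 0 < INR (S m)) by (apply lt_0_INR; lia).
  assert (h1 : / INR (fact k) <= (/ INR (S m)) ^ k * comp_count (S k) (S m)).
  { pose proof (comp_count_ge k (S m)) as h1.
    assert (h2 : INR (S m) ^ k <= INR (S (S m)) ^ k).
    { apply pow_incr. split; [lra|]. apply le_INR. lia. }
    assert (h3 : 0 < INR (S m) ^ k) by now apply pow_lt.
    rewrite pow_inv. apply Rmult_le_reg_l with (INR (fact k) * INR (S m) ^ k).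
    { now apply Rmult_lt_0_compat. }
    field_simplify; lra. }
  apply Rabs_le_between in h.
  assert (h2 : / INR (fact k) - SI k 1 (fun _ => 1) <= c * / INR (S m)) by lra.
  apply (Rmult_le_compat_l (INR (S m))) in h2; [|lra].
  replace (INR (S m) * (c * / INR (S m))) with c in h2 by (field; lra). exact h2.
Qed.

(** Grid sums of step [/ INR m] approximate numerator and denominator of [Avg] up to order [1 / m].
    Multiplied out, the main term has order [m ^ length vs] and the error one order less. *)
Lemma comp_sum_Avg (D : point -> Prop) (f : point -> R) (B : R) (vs : list point) :
  convex_set D -> convex_on D f -> (forall p, D p -> Rabs (f p) <= B) ->
  Forall D vs -> vs <> nil ->
  exists c, 0 <= c /\ forall m,
    Rabs (comp_sum vs m (perspective f (INR m)) -
          INR m * (Avg f vs * comp_count (length vs) m)) <= c * INR m ^ pred (length vs).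
Proof.
  intros hD hf hB hvs hne. destruct vs as [|v0 rest]; [easy|].
  inversion hvs as [|? ? h0 hr]; subst.
  simpl length. simpl pred. set (k := length rest).
  set (h := fun t => f (fun j => v0 j + comb t (map (pdiff v0) rest) j)).
  assert (hh : convex_bounded k 1 B h) by (apply simplex_param_convex_bounded with D; auto).
  assert (hB0 : 0 <= B) by (apply Rle_trans with (2 := hB v0 h0); apply Rabs_pos).
  set (w := SI k 1 (fun _ => 1)).
  assert (hw : 0 < w) by apply SI_one_pos.
  assert (eV : Avg f (v0 :: rest) = SI k 1 h / w) by reflexivity.
  set (V := Avg f (v0 :: rest)) in *.
  destruct (grid_sum_SI k) as [c1 [hc1 H1]].
  destruct (grid_sum_one_SI k) as [c2 H2].
  assert (hc2 : 0 <= c2).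
  { specialize (H2 0%nat). simpl INR in H2. rewrite Rinv_1, Rmult_1_r in H2.
    apply Rle_trans with (2 := H2). apply Rabs_pos. }
  exists (c1 * B + Rabs V * c2). split.
  { pose proof (Rabs_pos V). apply Rplus_le_le_0_compat; now apply Rmult_le_pos. }
  (* Level 0 has no grid step [/ INR m]; there the perspective vanishes identically. *)
  intros [|m].
  { simpl INR at 2. rewrite Rmult_0_l, Rminus_0_r.
    replace (comp_sum (v0 :: rest) 0 (perspective f (INR 0))) with 0.
    - rewrite Rabs_R0. apply Rmult_le_pos; [|apply pow_le, pos_INR].
      pose proof (Rabs_pos V). apply Rplus_le_le_0_compat; now apply Rmult_le_pos.
    - pose proof (comp_sum_scal_add (v0 :: rest) 0 (fun _ => 0) 0 0) as e.
      replace (perspective f (INR 0)) with (fun _ : point => 0 * 0 + 0).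
      + rewrite e. ring.
      + apply functional_extensionality. intros p. unfold perspective. simpl. ring. }
  specialize (H2 m). fold w in H2. set (x := INR (S m)) in *.
  assert (hx : 1 <= x) by (unfold x; rewrite S_INR; pose proof (pos_INR m); lra).
  assert (hx' : 0 < / x <= 1).
  { split. { apply Rinv_0_lt_compat. lra. } rewrite <- Rinv_1. apply Rinv_le_contravar; lra. }
  assert (ex : x * / x = 1) by (field; lra).
  specialize (H1 (S m) (/ x) B h hx'). fold x in H1. rewrite ex in H1.
  specialize (H1 ltac:(lra) hh).
  set (g := grid_sum k (S m) (/ x) h) in *.
  assert (eg : comp_sum (v0 :: rest) (S m) (perspective f x) = x * g).
  { rewrite (comp_sum_perm (v0 :: rest) (rest ++ v0 :: nil))
      by apply Permutation_cons_append.
    transitivity (comp_sum (rest ++ v0 :: nil) (S m)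
       (fun p => x * f (padd pzero (pscale (/ x) p)) + 0)).
    - f_equal. apply functional_extensionality. intros p. rewrite padd_pzero_l.
      unfold perspective. ring.
    - rewrite (comp_sum_scal_add _ _ (fun p => f (padd pzero (pscale (/ x) p)))).
      rewrite comp_sum_grid_sum, Rmult_0_r, Rplus_0_r. unfold g, h. f_equal. f_equal.
      apply functional_extensionality. intros t. f_equal.
      apply functional_extensionality. intros j. fold x. rewrite ex. unfold pzero. ring. }
  rewrite eg.
  set (n := comp_count (S k) (S m)) in *.
  assert (hxk : 0 < x ^ k) by (apply pow_lt; lra).
  (* Since [SI k 1 h = V * w], the two limits cancel and only the approximation errors remain. *)
  replace (x * g - x * (V * n)) with
    (x * x ^ k * (((/ x) ^ k * g - SI k 1 h) - V * ((/ x) ^ k * n - w))).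
  2:{ replace (SI k 1 h) with (V * w) by (rewrite eV; field; lra).
      rewrite pow_inv. field. lra. }
  rewrite Rabs_mult, (Rabs_pos_eq (x * x ^ k)) by (apply Rmult_le_pos; lra).
  assert (hd : Rabs (((/ x) ^ k * g - SI k 1 h) - V * ((/ x) ^ k * n - w)) <=
               (c1 * B + Rabs V * c2) * / x).
  { unfold Rminus at 1. eapply Rle_trans; [apply Rabs_triang|].
    rewrite Rabs_Ropp, (Rabs_mult V).
    pose proof (Rmult_le_compat_l _ _ _ (Rabs_pos V) H2). lra. }
  apply (Rmult_le_compat_l (x * x ^ k)) in hd; [|apply Rmult_le_pos; lra].
  apply Rle_trans with (1 := hd). right. field. lra.
Qed.

(** Summed over level [m], the inequality holds after multiplication by [INR m * N], up to an error
    of the order of [N]; dividing by [N] and letting [m] grow removes the error. *)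
Lemma Avg_split (D : point -> Prop) (f : point -> R) (bd : R) (vs A B : list point) :
  convex_set D -> convex_on D f -> (forall p, D p -> Rabs (f p) <= bd) ->
  Forall D vs -> Permutation vs (A ++ B) -> A <> nil -> B <> nil ->
  INR (length vs) * Avg f vs <=
  INR (length A) * Avg f A + INR (length B) * Avg f B.
Proof.
  intros hD hf hbd hvs hp hA0 hB0.
  assert (hAB : Forall D (A ++ B)) by (apply (Permutation_Forall hp); auto).
  apply Forall_app in hAB. destruct hAB as [hA hB].
  destruct (comp_sum_Avg D f bd vs hD hf hbd hvs) as [c [hc Hc]].
  { intros ->. apply Permutation_nil in hp. apply app_eq_nil in hp. tauto. }
  destruct (comp_sum_Avg D f bd A hD hf hbd hA hA0) as [cA [hcA HA]].
  destruct (comp_sum_Avg D f bd B hD hf hbd hB hB0) as [cB [hcB HB]].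
  assert (ek : length vs = (length A + length B)%nat).
  { rewrite (Permutation_length hp). apply length_app. }
  assert (ea : exists a, length A = S a) by (destruct A; [easy | eexists; reflexivity]).
  assert (eb : exists b, length B = S b) by (destruct B; [easy | eexists; reflexivity]).
  destruct ea as [a ea], eb as [b eb].
  set (V := Avg f vs) in *. set (VA := Avg f A) in *. set (VB := Avg f B) in *.
  rewrite ek in *. rewrite ea, eb in *. clear ek. simpl pred in *.
  set (K := (S a + S b)%nat) in *.
  assert (eK : K = S (a + S b)) by reflexivity.
  set (X := INR K * V - INR (S a) * VA - INR (S b) * VB).
  assert (X <= 0); [|unfold X in *; lra].
  (* The three approximation constants, with the factorial by which [comp_count_ge] bounds
     [y ^ (a + S b)] through [N]. *)
  set (e := INR K * (c + cA + cB) * INR (fact (a + S b))).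
  apply INR_bounded_nonpos with e. intros m'. set (m := S m').
  set (y := INR (S m)).
  assert (hy : 0 <= y) by apply pos_INR.
  pose proof (comp_sum_perspective_app D f A B m hD hf hA hB) as h.
  rewrite <- (comp_sum_perm _ _ hp), ea, eb in h.
  set (N := comp_count K m) in *.
  assert (h1 : INR m * (V * N) <= comp_sum vs m (perspective f (INR m)) + c * y ^ (a + S b)).
  { specialize (Hc m). apply Rabs_le_between in Hc.
    assert (c * INR m ^ (a + S b) <= c * y ^ (a + S b)).
    { apply Rmult_le_compat_l; auto. apply pow_incr. split; [apply pos_INR|].
      apply le_INR. lia. }
    change (a + S b)%nat with (pred K) in *. fold N in Hc. lra. }
  (* Each of the [m + 1] levels [j] adds an error of order [y ^ a * y ^ b], so the total is one
     order below [INR m * N]. *)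
  assert (h2 : sum_f_R0 (fun j =>
       comp_count (S b) (m - j) * comp_sum A j (perspective f (INR j)) +
       comp_count (S a) j * comp_sum B (m - j) (perspective f (INR (m - j)))) m <=
     sum_f_R0 (fun j =>
       (VA * (INR j * comp_count (S a) j * comp_count (S b) (m - j)) +
        VB * (INR (m - j) * comp_count (S b) (m - j) * comp_count (S a) j)) +
       (cA + cB) * (y ^ a * y ^ b)) m).
  { apply sum_Rle. intros j hj.
    assert (hq : forall i k, (i <= m)%nat -> 0 <= INR i ^ k <= y ^ k).
    { intros i k hi. split; [apply pow_le, pos_INR|]. apply pow_incr.
      split; [apply pos_INR|]. apply le_INR. lia. }
    assert (hn : forall i k, (i <= m)%nat -> 0 <= comp_count (S k) i <= y ^ k).
    { intros i k hi. split; [apply comp_count_nonneg|].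
      apply Rle_trans with (1 := comp_count_le k i). apply pow_incr.
      split; [apply pos_INR|]. apply le_INR. lia. }
    pose proof (HA j) as qa. apply Rabs_le_between in qa.
    pose proof (HB (m - j)%nat) as qb. apply Rabs_le_between in qb.
    pose proof (hq j a hj) as q1. pose proof (hq (m - j)%nat b ltac:(lia)) as q2.
    pose proof (hn j a hj) as n1. pose proof (hn (m - j)%nat b ltac:(lia)) as n2.
    set (nb := comp_count (S b) (m - j)) in *.
    set (na := comp_count (S a) j) in *.
    assert (s1 : nb * comp_sum A j (perspective f (INR j)) <=
                 VA * (INR j * na * nb) + cA * (y ^ a * y ^ b)).
    { apply Rle_trans with (nb * (INR j * (VA * na) + cA * INR j ^ a)).
      - apply Rmult_le_compat_l; lra.
      - assert (INR j ^ a * nb <= y ^ a * y ^ b) by (apply Rmult_le_compat; lra).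
        assert (cA * (INR j ^ a * nb) <= cA * (y ^ a * y ^ b))
          by now apply Rmult_le_compat_l.
        lra. }
    assert (s2 : na * comp_sum B (m - j) (perspective f (INR (m - j))) <=
                 VB * (INR (m - j) * nb * na) + cB * (y ^ a * y ^ b)).
    { apply Rle_trans with (na * (INR (m - j) * (VB * nb) + cB * INR (m - j) ^ b)).
      - apply Rmult_le_compat_l; lra.
      - assert (na * INR (m - j) ^ b <= y ^ a * y ^ b) by (apply Rmult_le_compat; lra).
        assert (cB * (na * INR (m - j) ^ b) <= cB * (y ^ a * y ^ b))
          by now apply Rmult_le_compat_l.
        lra. }
    lra. }
  apply (Rle_trans _ _ _ h) in h2. clear h.
  rewrite sum_plus, (sum_f_R0_lin_comb
    (fun j => INR j * comp_count (S a) j * comp_count (S b) (m - j))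
    (fun j => INR (m - j) * comp_count (S b) (m - j) * comp_count (S a) j)), sum_cte in h2.
  fold y in h2.
  (* The mean identity is used for [A], and for [B] after reversing the order of summation. *)
  pose proof (comp_count_mean (S a) (S b) m) as w1.
  pose proof (comp_count_mean (S b) (S a) m) as w2.
  rewrite (Nat.add_comm (S b)) in w2. fold K in w1, w2. fold N in w1, w2.
  rewrite (sum_f_R0_rev (fun j => INR j * comp_count (S b) j *
             comp_count (S a) (m - j))) in w2.
  rewrite (sum_eq _ (fun j => INR (m - j) * comp_count (S b) (m - j) *
             comp_count (S a) j)) in w2.
  2:{ intros i hi. now replace (m - (m - i))%nat with i by lia. }
  assert (ey : y ^ a * y ^ b * y = y ^ (a + S b)).
  { rewrite pow_add. simpl. ring. }
  assert (h3 : INR m * N * X <= INR K * (c + cA + cB) * y ^ (a + S b)).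
  { assert (hK : 0 < INR K) by (apply lt_0_INR; lia).
    match type of h2 with _ <= VA * ?sa + VB * ?sb + _ =>
      set (s1 := sa) in *; set (s2 := sb) in * end.
    assert (t : INR m * (V * N) <= VA * s1 + VB * s2 + (c + cA + cB) * y ^ (a + S b)).
    { rewrite <- ey in *. lra. }
    apply (Rmult_le_compat_l (INR K)) in t; [|lra].
    apply (f_equal (Rmult VA)) in w1. apply (f_equal (Rmult VB)) in w2.
    unfold X. lra. }
  pose proof (comp_count_ge (a + S b) m) as h4.
  fold y in h4. change (comp_count (S (a + S b)) m) with N in h4.
  assert (hN : 0 < N) by apply comp_count_pos.
  apply Rmult_le_reg_r with N; auto.
  assert (h5 : INR K * (c + cA + cB) * y ^ (a + S b) <=
               INR K * (c + cA + cB) * (INR (fact (a + S b)) * N)).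
  { apply Rmult_le_compat_l; auto. apply Rmult_le_pos; [apply pos_INR|lra]. }
  fold m. unfold e. lra.
Qed.

(** * Partitions of the vertex set *)

Lemma in_simplex_convex (x : nat -> point) (n : nat) : convex_set (in_simplex x n).
Proof.
  intros p q t [a [ha [ha1 hap]]] [b [hb [hb1 hbq]]] ht.
  exists (fun i => t * a i + (1 - t) * b i). split; [|split].
  - intros i hi. specialize (ha i hi). specialize (hb i hi). nra.
  - rewrite sum_f_R0_lin_comb, ha1, hb1. ring.
  - intros j. rewrite hap, hbq, <- sum_f_R0_lin_comb. apply sum_eq. intros. ring.
Qed.

Lemma sum_f_R0_single (a : nat -> R) (n k : nat) :
  (k <= n)%nat -> (forall i, (i <= n)%nat -> i <> k -> a i = 0) -> sum_f_R0 a n = a k.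
Proof.
  revert k. induction n as [|n IH]; intros k hk h.
  - now replace k with 0%nat by lia.
  - rewrite tech5. destruct (Nat.eq_dec k (S n)) as [->|hne].
    + rewrite sum_eq_R0; [ring|]. intros i hi. apply h; lia.
    + rewrite (IH k), (h (S n)); auto; try lia; ring.
Qed.

Lemma in_simplex_vertex (x : nat -> point) (n k : nat) : (k <= n)%nat -> in_simplex x n (x k).
Proof.
  intros hk. exists (fun i => if Nat.eqb i k then 1 else 0). split; [|split].
  - intros i _. destruct (Nat.eqb i k); lra.
  - rewrite (sum_f_R0_single _ n k); auto.
    + now rewrite Nat.eqb_refl.
    + intros i _ hi. apply Nat.eqb_neq in hi. now rewrite hi.
  - intros j. rewrite (sum_f_R0_single _ n k); auto.
    + rewrite Nat.eqb_refl. ring.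
    + intros i _ hi. apply Nat.eqb_neq in hi. rewrite hi. ring.
Qed.

(** * Boundedness of convex functions on a simplex *)

Lemma perspective_pscale (f : point -> R) (c : R) (v : point) :
  perspective f c (pscale c v) = c * f v.
Proof.
  unfold perspective. destruct (Req_dec c 0) as [->|hc]; [ring|]. do 2 f_equal.
  apply functional_extensionality. intros j. unfold pscale. field. auto.
Qed.

Lemma term_le_sum_f_R0 (a : nat -> R) (n i : nat) :
  (forall i, (i <= n)%nat -> 0 <= a i) -> (i <= n)%nat -> a i <= sum_f_R0 a n.
Proof.
  intros ha hi. induction n as [|n IH].
  - replace i with 0%nat by lia. simpl. lra.
  - rewrite tech5. destruct (Nat.eq_dec i (S n)) as [->|hne].
    + assert (0 <= sum_f_R0 a n); [|lra].
      rewrite <- (sum_eq_R0 (fun _ => 0) n) by auto. apply sum_Rle. auto.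
    + assert (a i <= sum_f_R0 a n) by (apply IH; [auto|lia]).
      specialize (ha (S n) (Nat.le_refl _)). lra.
Qed.

(** Jensen's inequality by induction over partial sums; the perspective handles partial weights that
    do not add up to 1, even when they are 0. *)
Lemma convex_on_simplex_le (x : nat -> point) (n : nat) (f : point -> R) (p : point) :
  convex_on (in_simplex x n) f -> in_simplex x n p ->
  f p <= sum_f_R0 (fun i => Rabs (f (x i))) n.
Proof.
  intros hf [a [ha [ha1 hap]]].
  set (D := in_simplex x n) in *.
  assert (H : forall m, (m <= n)%nat ->
    cone D (sum_f_R0 a m) (fun j => sum_f_R0 (fun i => a i * x i j) m) /\
    perspective f (sum_f_R0 a m) (fun j => sum_f_R0 (fun i => a i * x i j) m) <=
      sum_f_R0 (fun i => a i * f (x i)) m).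
  { assert (hc : forall i, (i <= n)%nat -> cone D (a i) (pscale (a i) (x i))).
    { intros i hi. apply cone_pscale; auto. now apply in_simplex_vertex. }
    induction m as [|m IH]; intros hm.
    - simpl. split; [now apply hc|].
      change (fun j => a 0%nat * x 0%nat j) with (pscale (a 0%nat) (x 0%nat)).
      rewrite perspective_pscale. lra.
    - destruct (IH ltac:(lia)) as [h1 h2]. rewrite !tech5.
      change (fun j => sum_f_R0 (fun i => a i * x i j) (S m)) with
        (padd (fun j => sum_f_R0 (fun i => a i * x i j) m) (pscale (a (S m)) (x (S m)))).
      split.
      + apply cone_padd; auto. apply in_simplex_convex.
      + eapply Rle_trans; [apply perspective_subadditive with D; auto|].
        rewrite perspective_pscale. lra. }
  destruct (H n (Nat.le_refl n)) as [_ h]. rewrite ha1 in h.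
  replace (fun j => sum_f_R0 (fun i => a i * x i j) n) with (pscale 1 p) in h.
  - rewrite perspective_pscale, Rmult_1_l in h. apply Rle_trans with (1 := h).
    apply sum_Rle. intros i hi. pose proof (Rle_abs (f (x i))).
    assert (a i <= 1) by (rewrite <- ha1; now apply term_le_sum_f_R0).
    specialize (ha i hi). pose proof (Rabs_pos (f (x i))). nra.
  - apply functional_extensionality. intros j. unfold pscale. rewrite hap. ring.
Qed.

(* [f] is bounded below because the centroid is a convex combination of any
   point [p] (with weight [1 / (n + 1)]) and another point of the simplex. *)
Lemma convex_on_simplex_bounded (x : nat -> point) (n : nat) (f : point -> R) :
  (1 <= n)%nat -> convex_on (in_simplex x n) f ->
  exists B, forall p, in_simplex x n p -> Rabs (f p) <= B.
Proof.
  intros hn hf.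
  set (M := sum_f_R0 (fun i => Rabs (f (x i))) n).
  set (w := / (INR n + 1)).
  set (c := fun j => sum_f_R0 (fun i => w * x i j) n).
  assert (hn1 : 1 <= INR n) by (apply (le_INR 1); auto).
  assert (hM : forall p, in_simplex x n p -> f p <= M)
    by (intros; now apply convex_on_simplex_le).
  assert (hM0 : 0 <= M) by (apply cond_pos_sum; intros; apply Rabs_pos).
  (* [M] bounds [f p] above; below, [(n + 1) * f c <= f p + n * f q] is combined with [f q <= M]. *)
  exists (M + (INR n + 1) * Rabs (f c) + INR n * M). intros p hp.
  pose proof hp as [a [ha [ha1 hap]]].
  assert (ha' : forall i, (i <= n)%nat -> a i <= 1)
    by (intros; rewrite <- ha1; now apply term_le_sum_f_R0).
  (* The weights [(1 - a i) / n] are solved for so that [w * p + (1 - w) * q] is the centroid [c];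
     they are nonnegative because [a i <= 1]. *)
  set (b := fun i => / INR n * 1 + (- / INR n) * a i).
  set (q := fun j => sum_f_R0 (fun i => b i * x i j) n).
  assert (hq : in_simplex x n q).
  { exists b. split; [|split]; auto.
    - intros i hi. unfold b. specialize (ha' i hi).
      assert (0 < / INR n) by (apply Rinv_0_lt_compat; lra). nra.
    - unfold b. rewrite (sum_f_R0_lin_comb (fun _ => 1)), sum_cte, ha1, S_INR.
      field. lra. }
  assert (hw : 0 <= w <= 1).
  { unfold w. split.
    - left. apply Rinv_0_lt_compat. lra.
    - rewrite <- Rinv_1. apply Rinv_le_contravar; lra. }
  pose proof (hf p q w hp hq hw) as h.
  replace (fun j => w * p j + (1 - w) * q j) with c in h.
  - specialize (hM q hq) as h1. specialize (hM p hp) as h2.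
    assert (h3 : (INR n + 1) * f c <= f p + INR n * f q).
    { apply (Rmult_le_compat_l (INR n + 1)) in h; [|lra].
      apply Rle_trans with (1 := h). right. unfold w. field. lra. }
    pose proof (Rle_abs (- f c)) as h4. rewrite Rabs_Ropp in h4.
    pose proof (Rabs_pos (f c)).
    apply Rabs_le_between. nra.
  - apply functional_extensionality. intros j. unfold c, q.
    rewrite hap, <- sum_f_R0_lin_comb. apply sum_eq. intros i _.
    unfold b, w. field. lra.
Qed.

(** * Cutting blocks along a labelling *)

Lemma filter_partition_perm (p : nat -> bool) (bs : list nat) :
  Permutation bs (filter p bs ++ filter (fun i => negb (p i)) bs).
Proof.
  induction bs as [|b bs IH]; simpl; auto.
  destruct (p b); simpl; auto. now apply Permutation_cons_app.
Qed.

Lemma filter_nil_negb (p : nat -> bool) (bs : list nat) :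
  filter p bs = nil -> filter (fun i => negb (p i)) bs = bs.
Proof.
  induction bs as [|b bs IH]; simpl; auto.
  destruct (p b); simpl; [easy|]. intros h. now rewrite IH.
Qed.

Lemma filter_negb_nil (p : nat -> bool) (bs : list nat) :
  filter (fun i => negb (p i)) bs = nil -> filter p bs = bs.
Proof.
  induction bs as [|b bs IH]; simpl; auto.
  destruct (p b); simpl; [|easy]. intros h. now rewrite IH.
Qed.

Lemma filter_all (p : nat -> bool) (bs : list nat) :
  (forall i, In i bs -> p i = true) -> filter p bs = bs.
Proof.
  intros h. apply forallb_filter_id. now apply forallb_forall.
Qed.

Lemma filter_none (p : nat -> bool) (bs : list nat) :
  (forall i, In i bs -> p i = false) -> filter p bs = nil.
Proof.
  intros h. induction bs as [|b bs IH]; simpl; auto.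
  rewrite h by now left. apply IH. intros i hi. apply h. now right.
Qed.

Lemma filter_filter (p q : nat -> bool) (bs : list nat) :
  filter p (filter q bs) = filter (fun i => andb (p i) (q i)) bs.
Proof.
  induction bs as [|b bs IH]; simpl; auto.
  destruct (q b); simpl; destruct (p b); simpl; now rewrite IH.
Qed.

(** The summand of [Fpart], extended to lists that are only parts of blocks. *)
Definition weighted_Avg (f : point -> R) (x : nat -> point) (bs : list nat) : R :=
  INR (length bs) * Avg f (map x bs).

Lemma weighted_Avg_nil (f : point -> R) (x : nat -> point) : weighted_Avg f x nil = 0.
Proof. unfold weighted_Avg. simpl. ring. Qed.

(** Induction on the largest label: [Avg_split] detaches the vertices labelled [S L]. If one part is
    empty, the split is an equality and is treated apart. *)
Lemma weighted_Avg_labelling (D : point -> Prop) (f : point -> R) (B : R)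
    (x : nat -> point) (c : nat -> nat) (L : nat) (bs : list nat) :
  convex_set D -> convex_on D f -> (forall p, D p -> Rabs (f p) <= B) ->
  (forall i, In i bs -> D (x i) /\ (c i <= L)%nat) ->
  weighted_Avg f x bs <=
  sum_f_R0 (fun l => weighted_Avg f x (filter (fun i => Nat.eqb (c i) l) bs)) L.
Proof.
  intros hD hf hB. revert bs. induction L as [|L IH]; intros bs hbs.
  - simpl. rewrite filter_all; [lra|].
    intros i hi. apply Nat.eqb_eq. apply hbs in hi. lia.
  - rewrite tech5.
    set (p := fun i => Nat.eqb (c i) (S L)).
    set (bs' := filter (fun i => negb (p i)) bs).
    assert (h1 : weighted_Avg f x bs <=
                 weighted_Avg f x bs' + weighted_Avg f x (filter p bs)).
    { destruct (filter p bs) as [|i0 r] eqn:e1.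
      { unfold bs'. rewrite filter_nil_negb by auto. rewrite weighted_Avg_nil. lra. }
      destruct bs' as [|i1 r'] eqn:e2; unfold bs' in e2.
      { apply filter_negb_nil in e2. rewrite <- e1, e2, weighted_Avg_nil. lra. }
      rewrite <- e1, <- e2. unfold weighted_Avg.
      pose proof (Avg_split D f B (map x bs) (map x (filter p bs))
        (map x (filter (fun i => negb (p i)) bs)) hD hf hB) as h.
      rewrite !length_map in h.
      rewrite Rplus_comm. apply h.
      - apply Forall_forall. intros v hv. apply in_map_iff in hv.
        destruct hv as [i [<- hi]]. now apply hbs.
      - rewrite <- map_app. apply Permutation_map. apply filter_partition_perm.
      - now rewrite e1.
      - now rewrite e2. }
    apply Rle_trans with (1 := h1). apply Rplus_le_compat_r.
    eapply Rle_trans; [apply IH|].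
    + intros i hi. unfold bs' in hi. apply filter_In in hi. destruct hi as [hi hp].
      destruct (hbs i hi) as [hd hc]. split; auto.
      unfold p in hp. apply Bool.negb_true_iff, Nat.eqb_neq in hp. lia.
    (* Removing the label [S L] beforehand does not affect the fibre of a label [l <= L]. *)
    + right. apply sum_eq. intros l hl. f_equal. unfold bs'. rewrite filter_filter.
      apply filter_ext. intros i. unfold p.
      destruct (Nat.eqb_spec (c i) l); simpl; auto.
      apply Bool.negb_true_iff, Nat.eqb_neq. lia.
Qed.

Lemma sum_f_R0_swap (a : nat -> nat -> R) (m n : nat) :
  sum_f_R0 (fun i => sum_f_R0 (fun j => a i j) n) m =
  sum_f_R0 (fun j => sum_f_R0 (fun i => a i j) m) n.
Proof.
  induction m as [|m IH]; simpl; auto.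
  now rewrite IH, <- sum_plus.
Qed.

Lemma in_block (c : nat -> nat) (n l i : nat) :
  In i (block c n l) <-> (i <= n)%nat /\ c i = l.
Proof.
  unfold block. rewrite filter_In, in_seq, Nat.eqb_eq. lia.
Qed.

(** The two filters commute, and by refinement all of [block cL n l'] carries a single label under
    [cK], so at most one term is nonzero. *)
Lemma sum_weighted_Avg_refine (f : point -> R) (x : nat -> point) (n : nat)
    (cK cL : nat -> nat) (l' : nat) :
  is_labelling n cK -> refines n cL cK ->
  sum_f_R0 (fun l => weighted_Avg f x
    (filter (fun i => Nat.eqb (cL i) l') (block cK n l))) n =
  weighted_Avg f x (block cL n l').
Proof.
  intros hK hLK.
  assert (e : forall l, filter (fun i => Nat.eqb (cL i) l') (block cK n l) =
                        filter (fun i => Nat.eqb (cK i) l) (block cL n l')).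
  { intros l. unfold block. rewrite !filter_filter. apply filter_ext.
    intros i. apply Bool.andb_comm. }
  destruct (block cL n l') as [|i0 r] eqn:e0.
  - rewrite weighted_Avg_nil. apply sum_eq_R0. intros l _.
    rewrite e. apply weighted_Avg_nil.
  - rewrite <- e0 in *.
    assert (h0 : In i0 (block cL n l')) by (rewrite e0; now left).
    apply in_block in h0. destruct h0 as [h0 h0'].
    assert (h : forall i, In i (block cL n l') -> cK i = cK i0).
    { intros i hi. apply in_block in hi. destruct hi as [hi hi'].
      apply hLK; auto. now rewrite hi', h0'. }
    rewrite (sum_f_R0_single _ n (cK i0)); auto.
    + rewrite e, filter_all; auto.
      intros i hi. apply Nat.eqb_eq. auto.
    + intros l _ hl. rewrite e, filter_none; [apply weighted_Avg_nil|].
      intros i hi. apply Nat.eqb_neq. rewrite (h i hi). auto.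
Qed.

Theorem theorem1 (n : nat) (hn : (1 <= n)%nat) (x : nat -> nat -> R)
    (hx0 : forall i j, (n <= j)%nat -> x i j = 0)
    (hind : affinely_independent x n)
    (f : (nat -> R) -> R) (hf : convex_on (in_simplex x n) f)
    (cK cL : nat -> nat) (hK : is_labelling n cK) (hL : is_labelling n cL)
    (hLK : refines n cL cK) :
  Fpart f x n cK <= Fpart f x n cL.
Proof.
  destruct (convex_on_simplex_bounded x n f hn hf) as [B hB].
  change (sum_f_R0 (fun l => weighted_Avg f x (block cK n l)) n <=
          sum_f_R0 (fun l => weighted_Avg f x (block cL n l)) n).
  (* Each block of [cL] is expanded over the blocks of [cK]; exchanging the sums leaves one
     inequality for each block of [cK]. *)
  rewrite (sum_eq (fun l => weighted_Avg f x (block cL n l)) (fun l' =>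
    sum_f_R0 (fun l => weighted_Avg f x
      (filter (fun i => Nat.eqb (cL i) l') (block cK n l))) n))
    by (intros; symmetry; now apply sum_weighted_Avg_refine).
  rewrite <- (sum_f_R0_swap (fun l l' => weighted_Avg f x
      (filter (fun i => Nat.eqb (cL i) l') (block cK n l)))).
  apply sum_Rle. intros l _.
  apply weighted_Avg_labelling with (in_simplex x n) B; auto.
  - apply in_simplex_convex.
  - intros i hi. apply in_block in hi. destruct hi as [hi _]. split; auto.
    now apply in_simplex_vertex.
Qed.
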